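(* There are universal constants $C,\widetilde{C}>0$, and for every $r>0$, $0<p\le1$ and $d\in\mathbb{N}$ a constant $C_{r,p,d}>0$, such that for all $r>0$, $0<p\le1$, $d\in\mathbb{N}$, and all $n,M\in\mathbb{N}$ with $M\ge3$, $$\varrho_{\lceil Cd\log(d+1)\,n\log(n+1)^2\log(M)\rceil}(\mathcal{A}^r_p(\mathbb{T}^d))_{L^2(\mathbb{T}^d)}\le\widetilde{C}\big(\sigma_n(\mathcal{A}^r_p(\mathbb{T}^d);\mathcal{T}^d)_{L^\infty(\mathbb{T}^d)}+(1+M)^{-r}\big),$$ and for all $n\in\mathbb{N}$ $$\varrho_{\lceil C_{r,p,d}\,n\log(n+1)^3\rceil}(\mathcal{A}^r_p(\mathbb{T}^d))_{L^2(\mathbb{T}^d)}\lesssim n^{-\frac rd-\frac1p+\frac12}.$$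
   Context: $\mathbb{T}^d=\mathbb{R}^d/\mathbb{Z}^d$ with normalized Haar measure; $L^\infty(\mathbb{T}^d)$ is the space of bounded measurable functions with the supremum norm (no a.e. identification). $\widehat f(k)=\int_{\mathbb{T}^d}f(x)\mathrm{e}^{-2\pi\mathrm{i}\langle k,x\rangle}\,\mathrm{d}x$, and $\mathcal{T}^d=(\mathrm{e}^{2\pi\mathrm{i}\langle k,\cdot\rangle})_{k\in\mathbb{Z}^d}$. $\log$ is the natural logarithm. Isotropic weighted Wiener space: for $r>0$, $0<p\le1$, $\mathcal{A}^r_p(\mathbb{T}^d)=\{f\in L^1(\mathbb{T}^d):\|f\|_{\mathcal{A}^r_p(\mathbb{T}^d)}<\infty\}$ with $\|f\|_{\mathcal{A}^r_p(\mathbb{T}^d)}=\big(\sum_{k\in\mathbb{Z}^d}(|\widehat f(k)|(1+\|k\|_{\ell^\infty})^r)^p\big)^{1/p}$; its elements are identified with their continuous representatives (their absolutely convergent Fourier series), so that point evaluations make sense. $\sigma_n(\mathcal{F};\mathcal{T}^d)_{L^\infty(\mathbb{T}^d)}=\sup_{\|f\|_{\mathcal{F}}\le1}\inf\{\|f-\sum_{k\in J}c_k\mathrm{e}^{2\pi\mathrm{i}\langle k,\cdot\rangle}\|_{L^\infty(\mathbb{T}^d)}:J\subset\mathbb{Z}^d,|J|\le n,(c_k)\in\mathbb{C}^J\}$. Sampling numbers: $\varrho_m(\mathcal{F})_X=\inf_{t_1,\ldots,t_m\in\mathbb{T}^d}\inf_{R:\mathbb{C}^m\to X}\sup_{\|f\|_{\mathcal{F}}\le1}\|f-R(f(t_1),\ldots,f(t_m))\|_X$,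 with $R$ ranging over all (not necessarily linear) maps. $a_n\lesssim b_n$ means $a_n\le c\,b_n$ for all $n\in\mathbb{N}$ with a constant $c>0$ independent of $n$ (it may depend on $r,p,d$). *)

(* Defs.v *)
From HB Require Import structures.
From mathcomp Require Import all_boot all_order all_algebra.
From mathcomp Require Import finmap.
From mathcomp Require Import complex.
From mathcomp Require Import all_classical all_reals all_analysis.

Set Implicit Arguments.
Unset Strict Implicit.
Unset Printing Implicit Defensive.

Import Order.TTheory GRing.Theory Num.Theory.
Import numFieldTopology.Exports numFieldNormedType.Exports.
Import ComplexField.Normc.

Local Open Scope classical_set_scope.
Local Open Scope ring_scope.
Local Open Scope complex_scope.

Section product_probability.
Context (d1 d2 : measure_display) (T1 : measurableType d1)
  (T2 : measurableType d2) (R : realType).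
Variables (P1 : probability T1 R) (P2 : probability T2 R).

Definition prod_prob : set (T1 * T2) -> \bar R := (P1 \x P2)%E.

HB.instance Definition _ := Measure.on prod_prob.

Let prod_probT : prod_prob [set: _] = 1%E.
Proof.
have -> : prod_prob [set: _] = (P1 [set: _] * P2 [set: _])%E.
  by rewrite -product_measure1E// setXTT.
by rewrite !probability_setT mule1.
Qed.

HB.instance Definition _ :=
  Measure_isProbability.Build _ _ _ prod_prob prod_probT.

End product_probability.

Section power_probability.
Context (dd : measure_display) (T : measurableType dd) (R : realType).

Definition tuple_cons (n : nat) (x : T * n.-tuple T) : n.+1.-tuple T :=
  [the n.+1.-tuple T of x.1 :: x.2].

Lemma measurable_tuple_cons (n : nat) :
  measurable_fun [set: T * n.-tuple T] (@tuple_cons n).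
Proof. exact: measurable_cons. Qed.

HB.instance Definition _ (n : nat) :=
  isMeasurableFun.Build _ _ _ _ (@tuple_cons n) (@measurable_tuple_cons n).

(** The n-fold product of [P], transported from nested pairs to tuples. *)
Fixpoint power_prob (P : probability T R) (n : nat) :
    probability (n.-tuple T) R :=
  if n is n'.+1 then distribution (prod_prob P (power_prob P n')) (@tuple_cons n')
  else \d_([tuple] : 0.-tuple T).

End power_probability.

(** Points of T^d are represented by points of R^d, functions on T^d by
    Z^d-periodic functions on R^d, and integration against the normalized Haar
    measure by integration over the fundamental domain [0, 1]^d. *)

Definition torus_pt (R : realType) (d : nat) := d.-tuple (measurableTypeR R).

Definition haar (R : realType) (d : nat) :
    probability (d.-tuple (measurableTypeR R)) R :=
  power_prob (uniform_prob (@ltr01 R)) d.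

Section torus.
Context {R : realType} {d : nat}.
Implicit Types (f g : torus_pt R d -> R[i]) (k : d.-tuple int) (x : torus_pt R d).

Definition Zd_periodic f := forall x k,
  f [tuple (tnth x i : R) + (tnth k i)%:~R | i < d] = f x.

Definition continuous_torus f :=
  continuous (fun v : 'rV[R]_d => (f [tuple v ord0 i | i < d] : R[i]^o)).

Definition measurable_torus f :=
  measurable_fun [set: torus_pt R d] (fun x => complex.Re (f x) : measurableTypeR R) /\
  measurable_fun [set: torus_pt R d] (fun x => complex.Im (f x) : measurableTypeR R).

Definition integrable_torus f :=
  (haar R d).-integrable [set: torus_pt R d] (fun x => (complex.Re (f x))%:E) /\
  (haar R d).-integrable [set: torus_pt R d] (fun x => (complex.Im (f x))%:E).

Definition integral_torus f : R[i] :=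
  (\int[haar R d]_x complex.Re (f x)) +i* (\int[haar R d]_x complex.Im (f x)).

Definition L2norm f : \bar R :=
  Lnorm (haar R d) 2%:E (fun x => (normc (f x))%:E).

Definition supnorm f : \bar R :=
  ereal_sup [set (normc (f x))%:E | x in [set: torus_pt R d]].

Definition L2 : set (torus_pt R d -> R[i]) :=
  [set f | [/\ Zd_periodic f, measurable_torus f & (L2norm f < +oo)%E]].

Definition pairing k x : R := \sum_(i < d) (tnth k i)%:~R * tnth x i.

(** exp(2 pi i <k, x>) *)
Definition expi k x : R[i] :=
  cos (2 * pi * pairing k x) +i* sin (2 * pi * pairing k x).

Definition fourier_coef f k : R[i] :=
  integral_torus (fun x => f x * (expi k x)^*).

Definition normInf k : nat := \big[maxn/0%N]_(i < d) `|tnth k i|%N.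

Definition wiener_norm (r p : R) f : \bar R :=
  ((\esum_(k in [set: d.-tuple int])
      ((normc (fourier_coef f k) * (1 + (normInf k)%:R) `^ r) `^ p)%:E)
    `^ p^-1)%E.

(** A class in L^1 with finite norm is represented by its continuous member. *)
Definition wiener (r p : R) : set (torus_pt R d -> R[i]) :=
  [set f | [/\ Zd_periodic f, continuous_torus f, integrable_torus f
             & (wiener_norm r p f < +oo)%E]].

Definition wiener_ball (r p : R) : set (torus_pt R d -> R[i]) :=
  [set f | wiener r p f /\ (wiener_norm r p f <= 1)%E].

Definition trig_poly (J : {fset d.-tuple int}) (c : d.-tuple int -> R[i]) x :
  R[i] := \sum_(k <- J) c k * expi k x.

Definition best_nterm_err (n : nat) f : \bar R :=
  ereal_inf [set e | exists J c, (#|` J| <= n)%N /\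
    e = supnorm (fun x => f x - trig_poly J c x)].

(** In the next two definitions [B] is the unit ball of the function class. *)
Definition best_nterm_width (n : nat) (B : set (torus_pt R d -> R[i])) : \bar R :=
  ereal_sup [set best_nterm_err n f | f in B].

Definition sampling_number (m : nat) (B : set (torus_pt R d -> R[i])) : \bar R :=
  ereal_inf [set
    ereal_inf [set
      ereal_sup [set L2norm (fun x => f x - Rec (fun j => f (t j)) x) | f in B]
      | Rec in [set Rec : ('I_m -> R[i]) -> torus_pt R d -> R[i]
                    | forall y, L2 (Rec y)]]
    | t in [set: 'I_m -> torus_pt R d]].

End torus.

Definition natceil {R : realType} (x : R) : nat := `|Num.ceil x|%N.

(* Main.v *)
(**
  The decoder returns any member of the unit ball that interpolates the data, so
  one has to bound the L2 norm of a difference [f - g] of two members of the ball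
  that agree at the sample points. These points lie on the grid of mesh 1/(2M+1),
  on which the characters with frequencies in [[-M, M]^d] are orthonormal and all
  others alias to them.

  A random choice of m of the grid points, m of order s log(s)^2 log(N) with N
  the cardinality of the grid, has the following property: a polynomial Q with
  box frequencies whose coefficients satisfy |c|_1 <= sqrt(s) |c|_2 obeys
  |c|_2 <= 4 max_j |Q(t_j)|. Indeed |Q|^2 exceeds some dyadic level 2^(i-1) |c|_2^2
  on a fraction 1/(2^i log s) of the grid; Maurey's method approximates Q at the
  accuracy of this level by a mean of s log(s)/2^i characters, and a union bound
  over these means shows that the sample hits all their level sets.

  For the first bound, the difference of the two best n-term approximants is
  2n-sparse on the grid. For the second one, the coefficients of [f - g] are
  concentrated on O(n) frequencies up to an l1 error n^(1 - r/d - 1/p), and either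
  the property applies or this error dominates. Frequencies outside the box cost
  (1+M)^(-r) in the sup norm, by Fourier inversion for continuous functions with
  summable coefficients.
*)
Require Import Defs.
From mathcomp Require Import all_boot all_order all_algebra.
From mathcomp Require Import finmap complex.
From mathcomp Require Import all_classical all_reals all_analysis.
From mathcomp Require Import measurable_realfun zify ring lra.

Set Implicit Arguments.
Unset Strict Implicit.
Unset Printing Implicit Defensive.

Import Order.TTheory GRing.Theory Num.Theory.
Import numFieldTopology.Exports numFieldNormedType.Exports.
Import ComplexField.Normc.
Local Open Scope ring_scope.

(** * Probabilistic method on finite products *)

(** The polynomials form a continuum, to which no union bound applies. Means of L atoms have at most
    (4N+1)^L level sets, a family fixed before the sample is drawn, and a sample that hits all the
    dense ones serves every polynomial at once. At level i density is of order 1/(2^i log s) and L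
    of order s log(s)/2^i, so the condition that m times the density dominates L log N reads m of
    order s log(s)^2 log N whatever i is: the powers of 2 cancel. One logarithm of s counts the
    levels; the other makes the exceptional set of the approximation small against the density of
    the level. Hitting a level set yields one large value and no mean square. A maximum is enough,
    because members of the ball that interpolate the same data differ by 0 at every sample point, so
    the box part of their difference is uniformly small there. The exponent 1/2 of the second bound
    arises when an l1 error is turned into an l2 error, through division by the square root of the
    number of retained frequencies. *)

Lemma expR_le_quad (R : realType) (x : R) :
  x <= 2^-1 -> expR x <= 1 + x + 2 * x ^+ 2.
Proof.
move=> x2; have x1 : 0 < 1 - x by lra.
have h : 1 - x <= expR (- x) by have := expR_ge1Dx (- x); lra.
have e0 := expR_gt0 x.
have : expR x * (1 - x) <= 1.
  by rewrite -[leRHS](mulfV (lt0r_neq0 e0)) -expRN ler_pM2l.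
move=> le1.
have : 1 <= (1 + x + 2 * x ^+ 2) * (1 - x).
  have : 0 <= x ^+ 2 * (1 - 2 * x) by apply: mulr_ge0; [exact: sqr_ge0|lra].
  have -> : (1 + x + 2 * x ^+ 2) * (1 - x) = 1 + x ^+ 2 * (1 - 2 * x) by ring.
  lra.
by move=> /(le_trans le1); rewrite ler_pM2r.
Qed.

Section ProductWeights.
Context (R : realType) (Om : finType) (w : Om -> R).
Hypothesis w_ge0 : forall k, 0 <= w k.
Hypothesis w_sum1 : \sum_k w k = 1.

Lemma sum_prod_weights L : \sum_(o : {ffun 'I_L -> Om}) \prod_l w (o l) = 1.
Proof.
rewrite -(bigA_distr_bigA (fun _ k => w k)) big1 // => i _; exact: w_sum1.
Qed.

Lemma chernoff_tail (X : Om -> R) L (u : R) :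
  \sum_k w k * X k = 0 -> (forall k, `|X k| <= 2) -> 0 <= u <= 4 ->
  \sum_(o : {ffun 'I_L -> Om} | L%:R * u <= \sum_l X (o l)) \prod_l w (o l)
    <= expR (- (L%:R * u ^+ 2 / 32)).
Proof.
move=> X0 X2 /andP[u0 u4].
(* The square of [X] is at most 4, so one coordinate contributes at most [- lam * u + 8 * lam ^+ 2]
   to the exponent, which is minimal at this [lam]; [u <= 4] keeps [lam * X k] in the range of
   [expR_le_quad]. *)
pose lam := u / 16.
have prodw0 (o : {ffun 'I_L -> Om}) : 0 <= \prod_l w (o l).
  by apply: prodr_ge0 => l _.
apply: (@le_trans _ _ (\sum_(o : {ffun 'I_L -> Om})
   (\prod_l w (o l)) * expR (lam * (\sum_l X (o l) - L%:R * u)))).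
  rewrite [leRHS](bigID (fun o : {ffun 'I_L -> Om} =>
     L%:R * u <= \sum_l X (o l))) /=.
  apply: ler_wpDr.
    by apply: sumr_ge0 => o _; rewrite mulr_ge0 // expR_ge0.
  apply: ler_sum => o ho; rewrite ler_peMr // -[leLHS]expR0 ler_expR.
  apply: mulr_ge0; last by rewrite subr_ge0.
  by rewrite /lam; lra.
have -> : \sum_(o : {ffun 'I_L -> Om})
   (\prod_l w (o l)) * expR (lam * (\sum_l X (o l) - L%:R * u))
  = expR (- (lam * u)) ^+ L * (\sum_k w k * expR (lam * X k)) ^+ L.
  have pw (x : R) : x ^+ L = \prod_(l < L) x by rewrite prodr_const card_ord.
  rewrite -exprMn mulr_sumr pw.
  rewrite bigA_distr_bigA; apply: eq_bigr => o _.
  rewrite !big_split /= mulrCA; congr (_ * _).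
  rewrite -!expR_sum -expRD; congr expR.
  rewrite -mulr_sumr sumr_const card_ord -mulr_natl; ring.
have h : \sum_k w k * expR (lam * X k) <= expR (u ^+ 2 / 32).
  apply: le_trans (expR_ge1Dx _).
  apply: (@le_trans _ _ (\sum_k (w k + lam * (w k * X k) + w k * (u ^+ 2 / 32)))).
    apply: ler_sum => k _.
    have Xk := X2 k.
    have lX : lam * X k <= 2^-1.
      have : lam * X k <= lam * 2.
        apply: ler_wpM2l; first by rewrite /lam; lra.
        exact: le_trans (ler_norm _) Xk.
      rewrite /lam; lra.
    have -> : w k + lam * (w k * X k) + w k * (u ^+ 2 / 32)
       = w k * (1 + lam * X k + u ^+ 2 / 32) by ring.
    apply: ler_wpM2l => //; apply: le_trans (expR_le_quad lX) _.
    rewrite lerD2l exprMn.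
    have : X k ^+ 2 <= 4.
      rewrite -real_normK ?num_real // (_ : 4 = 2 ^+ 2); last by ring.
      by rewrite lerXn2r // nnegrE.
    move=> Xk2; have := ler_wpM2l (sqr_ge0 lam) Xk2; rewrite /lam; lra.
  rewrite !big_split /= -mulr_sumr X0 mulr0 addr0 w_sum1 lerD2l.
  by rewrite -mulr_suml w_sum1 mul1r.
rewrite -exprMn.
apply: (@le_trans _ _ ((expR (- (lam * u)) * expR (u ^+ 2 / 32)) ^+ L)).
  apply: lerXn2r; rewrite ?nnegrE.
  - rewrite mulr_ge0 ?expR_ge0 //; apply: sumr_ge0 => k _.
    by rewrite mulr_ge0 ?expR_ge0.
  - by rewrite mulr_ge0 ?expR_ge0.
  - by rewrite ler_wpM2l ?expR_ge0.
by rewrite -expRD -expRM_natl ler_expR /lam; lra.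
Qed.

Lemma exists_le_mean L (F : {ffun 'I_L -> Om} -> R) :
  exists o, F o <= \sum_(o : {ffun 'I_L -> Om}) (\prod_l w (o l)) * F o.
Proof.
set S := \sum_(o : {ffun 'I_L -> Om}) (\prod_l w (o l)) * F o.
apply: contrapT => /forallNP H.
have prodw0 (o : {ffun 'I_L -> Om}) : 0 <= \prod_l w (o l).
  by apply: prodr_ge0 => l _.
have h0 : \sum_(o : {ffun 'I_L -> Om}) (\prod_l w (o l)) * (F o - S) = 0.
  under eq_bigr do rewrite mulrBr.
  by rewrite sumrB -mulr_suml sum_prod_weights mul1r subrr.
have pos o : 0 < F o - S by rewrite subr_gt0 ltNge; apply/negP/H.
have := sum_prod_weights L.
rewrite big1 => [/eqP|o _]; first by rewrite eq_sym oner_eq0.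
have : (\prod_l w (o l)) * (F o - S) == 0.
  have := h0 => /eqP; rewrite psumr_eq0.
    by move=> /allP /(_ o); rewrite mem_index_enum => /(_ isT).
  by move=> o' _; rewrite mulr_ge0 // ltW.
by rewrite mulf_eq0 => /orP[/eqP //|]; rewrite gt_eqF.
Qed.

(** For fixed [t], [chernoff_tail] controls four one-sided tails: two functions, two signs.
    Averaging the [mu]-mass of the bad points over [o] then yields a single tuple. In the
    application [phi] and [psi] are real and imaginary parts of complex atoms. *)
Lemma maurey_approximation (T : finType) (phi psi : Om -> T -> R) (mu : T -> R) L (u : R) :
  (forall k t, `|phi k t| <= 1) -> (forall k t, `|psi k t| <= 1) ->
  (forall t, 0 <= mu t) -> 0 <= u <= 4 ->
  exists o : {ffun 'I_L -> Om},
  \sum_(t | (L%:R * u <= `|\sum_l (phi (o l) t - \sum_k w k * phi k t)|) ||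
            (L%:R * u <= `|\sum_l (psi (o l) t - \sum_k w k * psi k t)|)) mu t
   <= 4 * expR (- (L%:R * u ^+ 2 / 32)) * \sum_t mu t.
Proof.
move=> hphi hpsi mu0 hu.
pose D (f : Om -> T -> R) (o : {ffun 'I_L -> Om}) t :=
  \sum_l (f (o l) t - \sum_k w k * f k t).
have tail (f : Om -> T -> R) (hf : forall k t, `|f k t| <= 1) t (s : bool) :
  \sum_(o : {ffun 'I_L -> Om} | L%:R * u <= (-1) ^+ s * D f o t) \prod_l w (o l)
   <= expR (- (L%:R * u ^+ 2 / 32)).
  pose X k := (-1) ^+ s * (f k t - \sum_k w k * f k t).
  have E (o : {ffun 'I_L -> Om}) : (-1) ^+ s * D f o t = \sum_l X (o l).
    by rewrite mulr_sumr.
  under eq_bigl do rewrite E; apply: chernoff_tail.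
  - under eq_bigr => k _ do rewrite /X mulrCA mulrBr.
    by rewrite -mulr_sumr sumrB -mulr_suml w_sum1 mul1r subrr mulr0.
  - move=> k; rewrite normrM normrX normrN1 expr1n mul1r.
    have : `|\sum_k w k * f k t| <= 1.
      apply: le_trans (ler_norm_sum _ _ _) _.
      rewrite -w_sum1; apply: ler_sum => j _.
      by rewrite normrM ger0_norm // ler_piMr.
    have := ler_normB (f k t) (\sum_k w k * f k t); have := hf k t; lra.
  - exact: hu.
have [om hom] := exists_le_mean (fun o : {ffun 'I_L -> Om} =>
  \sum_(t | (L%:R * u <= `|D phi o t|) || (L%:R * u <= `|D psi o t|)) mu t).
exists om; apply: le_trans hom _.
have absE (y z : R) : y <= `|z| ->
    (y <= (-1) ^+ false * z) || (y <= (-1) ^+ true * z).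
  by rewrite expr0 expr1 mul1r mulN1r ler_normr.
pose e := expR (- (L%:R * u ^+ 2 / 32)).
apply: (@le_trans _ _ (\sum_(t : T) mu t * (4 * e))); last first.
  by rewrite -mulr_suml mulrC.
under eq_bigr do rewrite [X in _ * X]big_mkcond mulr_sumr.
rewrite exchange_big /=; apply: ler_sum => t _.
pose W (o : {ffun 'I_L -> Om}) := \prod_l w (o l).
have W0 o' : 0 <= W o' by apply: prodr_ge0 => l _.
pose ind f s o' : R := if L%:R * u <= (-1) ^+ s * D f o' t then W o' else 0.
apply: (@le_trans _ _ (mu t * \sum_o' (ind phi false o' + ind phi true o'
     + (ind psi false o' + ind psi true o')))); last first.
  apply: ler_wpM2l => //; rewrite !big_split /= /ind -!big_mkcond /=.
  have := tail _ hphi t false; have := tail _ hphi t true.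
  have := tail _ hpsi t false; have := tail _ hpsi t true.
  rewrite /W /e; lra.
rewrite mulr_sumr; apply: ler_sum => o' _.
have ind0 f s : 0 <= ind f s o' by rewrite /ind; case: ifP.
have i1 := ind0 phi false; have i2 := ind0 phi true.
have i3 := ind0 psi false; have i4 := ind0 psi true.
rewrite -/(W o'); case: ifPn => h; last by rewrite mulr0 mulr_ge0 //; lra.
rewrite mulrC; apply: ler_wpM2l => //.
case/orP: h => /absE/orP[] h.
- have : ind phi false o' = W o' by rewrite /ind h.
  lra.
- have : ind phi true o' = W o' by rewrite /ind h.
  lra.
- have : ind psi false o' = W o' by rewrite /ind h.
  lra.
- have : ind psi true o' = W o' by rewrite /ind h.
  lra.
Qed.

End ProductWeights.

(** The coordinates of a uniformly chosen [t] are independent, so the sum is the m-th power of |G| -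
    |A|/2, which is at most |G| (1 - a/2). *)
Lemma sum_half_powers (R : realType) (G : finType) (A : {set G}) m (a : R) :
  a * #|G|%:R <= #|A|%:R ->
  \sum_(t : {ffun 'I_m -> G}) 2^-1 ^+ #|[set j | t j \in A]|
    <= #|G|%:R ^+ m * expR (- (a * m%:R / 2)).
Proof.
move=> aA.
have [G0|G0] := posnP #|G|.
  have g0 (g : G) : False by have := card0_eq G0 g; rewrite inE.
  case: m => [|m].
    rewrite expr0 mulr0 mul0r oppr0 expR0 mul1r.
    rewrite (eq_bigr (fun=> 1)); last first.
      by move=> t _; rewrite -(expr0 (2^-1)); congr (_ ^+ _); apply: eq_card0 => -[].
    by rewrite sumr_const card_ffun card_ord expn0.
  by rewrite big1 ?mulr_ge0 ?exprn_ge0 ?expR_ge0 // => t; case: (g0 (t ord0)).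
have -> : \sum_(t : {ffun 'I_m -> G}) 2^-1 ^+ #|[set j | t j \in A]|
  = (\sum_(g : G) (if g \in A then 2^-1 else 1)) ^+ m :> R.
  rewrite -[in RHS](card_ord m) -prodr_const bigA_distr_bigA.
  apply: eq_bigr => t _; rewrite -prodr_const [LHS]big_mkcond /=.
  by apply: eq_bigr => j _; rewrite inE.
have -> : \sum_(g : G) (if g \in A then 2^-1 else 1) = #|G|%:R - #|A|%:R / 2 :> R.
  rewrite (eq_bigr (fun g => 1 - (if g \in A then 2^-1 else 0))); last first.
    by move=> g _; case: ifP => _; lra.
  by rewrite sumrB -big_mkcond /= !sumr_const -[X in _ - X]mulr_natl.
have G0' : 0 < #|G|%:R :> R by rewrite ltr0n.
apply: (@le_trans _ _ ((#|G|%:R * expR (- (a / 2))) ^+ m)); last first.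
  by rewrite exprMn -expRM_natl -mulrN ler_wpM2l ?exprn_ge0 // ler_expR; lra.
apply: lerXn2r; rewrite ?nnegrE ?mulr_ge0 ?expR_ge0 //.
  have : #|A|%:R <= #|G|%:R :> R by rewrite ler_nat max_card.
  have : 0 <= #|A|%:R :> R by [].
  lra.
apply: (@le_trans _ _ (#|G|%:R * (1 - a / 2))); first by lra.
by rewrite ler_wpM2l //; have := expR_ge1Dx (- (a / 2)).
Qed.

(** Markov's inequality for the half powers: if [t] hits [A i] only h times, with h at most
    [a i * m / 4], then [expR (a i * m / 4)] times 2^(-h) is at least (e/2)^h, hence at least 1. So
    the expected number of badly hit sets is below 1. *)
Lemma exists_sample (R : realType) (G I : finType) (P : pred I)
    (A : I -> {set G}) (a : I -> R) m :
  (0 < #|G|)%N ->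
  (forall i, P i -> a i * #|G|%:R <= #|A i|%:R) ->
  \sum_(i | P i) expR (- (a i * m%:R / 4)) < 1 ->
  exists t : {ffun 'I_m -> G}, forall i, P i ->
    a i * m%:R / 4 < #|[set j | t j \in A i]|%:R.
Proof.
move=> G0 aA sum1; apply: contrapT => /forallNP H.
pose bad i (t : {ffun 'I_m -> G}) : R :=
  if #|[set j | t j \in A i]|%:R <= a i * m%:R / 4 then 1 else 0.
have bad0 i t : 0 <= bad i t by rewrite /bad; case: ifP.
have : #|G|%:R ^+ m <= \sum_(t : {ffun 'I_m -> G}) \sum_(i | P i) bad i t.
  rewrite -natrX -[m in (_ ^ m)%N]card_ord -card_ffun -sum1_card natr_sum big_mkcond /=.
  apply: ler_sum => t _; have /existsNP[i /not_implyP[Pi]] := H t.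
  move/negP; rewrite -leNgt => le; rewrite (bigD1 i) //= /bad le.
  by rewrite lerDl; apply: sumr_ge0 => i' _; exact: bad0.
rewrite exchange_big /=.
have : \sum_(i | P i) \sum_(t : {ffun 'I_m -> G}) bad i t
   <= \sum_(i | P i) (#|G|%:R ^+ m * expR (- (a i * m%:R / 4))).
  apply: ler_sum => i Pi.
  apply: (@le_trans _ _ (expR (a i * m%:R / 4) *
     \sum_(t : {ffun 'I_m -> G}) 2^-1 ^+ #|[set j | t j \in A i]|)).
    rewrite mulr_sumr; apply: ler_sum => t _; rewrite /bad; case: ifP => [le|_].
      apply: (@le_trans _ _ (expR 1 ^+ #|[set j | t j \in A i]|
         * 2^-1 ^+ #|[set j | t j \in A i]|)).
        rewrite -exprMn exprn_ege1 //.
        by have := expR_ge1Dx (1 : R); lra.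
      by rewrite ler_wpM2r ?exprn_ge0 // -expRM_natl mulr1 ler_expR.
    by rewrite mulr_ge0 ?expR_ge0 ?exprn_ge0.
  apply: le_trans (ler_wpM2l (expR_ge0 _) (sum_half_powers m (aA i Pi))) _.
  rewrite mulrCA ler_wpM2l ?exprn_ge0 // -expRD ler_expR; lra.
rewrite -mulr_sumr => /[swap] /le_trans h /h.
rewrite -[X in X <= _]mulr1 ler_pM2l; last by rewrite exprn_gt0 // ltr0n.
by rewrite leNgt sum1.
Qed.

(** * Sampling discretization for effectively sparse sums *)

Section NormcTheory.
Context {R : rcfType}.
Implicit Types z : complex R.

Lemma normc_ge0 z : 0 <= normc z.
Proof. by case: z => a b; rewrite /normc sqrtr_ge0. Qed.

Lemma sqr_normcE z : normc z ^+ 2 = complex.Re z ^+ 2 + complex.Im z ^+ 2.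
Proof. by case: z => a b /=; rewrite sqr_sqrtr // addr_ge0 ?sqr_ge0. Qed.

Lemma le_normc_sum (I : Type) (r : seq I) (P : pred I) (F : I -> complex R) :
  normc (\sum_(i <- r | P i) F i) <= \sum_(i <- r | P i) normc (F i).
Proof.
elim/big_rec2: _ => [|i y x _ le]; first by rewrite normc0.
by apply: le_trans (le_normcD _ _) _; rewrite lerD2l.
Qed.

Lemma normr_Re_le z : `|complex.Re z| <= normc z.
Proof.
rewrite -(@ler_sqr _ _ _) ?nnegrE ?normc_ge0 //.
by rewrite real_normK ?num_real // sqr_normcE lerDl sqr_ge0.
Qed.

Lemma normr_Im_le z : `|complex.Im z| <= normc z.
Proof.
rewrite -(@ler_sqr _ _ _) ?nnegrE ?normc_ge0 //.
by rewrite real_normK ?num_real // sqr_normcE lerDr sqr_ge0.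
Qed.

Lemma normc_le_Re_Im z : normc z <= `|complex.Re z| + `|complex.Im z|.
Proof.
rewrite -(@ler_sqr _ _ _) ?nnegrE ?normc_ge0 ?addr_ge0 //.
rewrite sqr_normcE sqrrD !real_normK ?num_real //.
by rewrite -addrA lerD2l lerDr mulrn_wge0 // mulr_ge0.
Qed.

Lemma Re_Im_le_normc z :
  (`|complex.Re z| + `|complex.Im z|) ^+ 2 <= 2 * normc z ^+ 2.
Proof.
rewrite sqr_normcE sqrrD -mulr_natl.
rewrite -[in leRHS](real_normK (num_real (complex.Re z))).
rewrite -[in leRHS](real_normK (num_real (complex.Im z))).
have := sqr_ge0 (`|complex.Re z| - `|complex.Im z|); rewrite sqrrB; lra.
Qed.

Lemma Re_sum (I : Type) (r : seq I) (P : pred I) (F : I -> complex R) :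
  complex.Re (\sum_(i <- r | P i) F i) = \sum_(i <- r | P i) complex.Re (F i).
Proof. by apply: (big_morph (@complex.Re R)) => // -[a b] [c d]. Qed.

Lemma Im_sum (I : Type) (r : seq I) (P : pred I) (F : I -> complex R) :
  complex.Im (\sum_(i <- r | P i) F i) = \sum_(i <- r | P i) complex.Im (F i).
Proof. by apply: (big_morph (@complex.Im R)) => // -[a b] [c d]. Qed.

Lemma Re_realM (x : R) z : complex.Re (x%:C%C * z) = x * complex.Re z.
Proof. by case: z => a b /=; ring. Qed.

Lemma Im_realM (x : R) z : complex.Im (x%:C%C * z) = x * complex.Im z.
Proof. by case: z => a b /=; ring. Qed.

Lemma normc_real (x : R) : normc x%:C%C = `|x|.
Proof. by rewrite /normc /= expr0n addr0 sqrtr_sqr. Qed.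

End NormcTheory.

(** Twice the largest threshold [2 ^+ i / 2] below [x] is already at least [x]; the summand [2^-1]
    covers an [x] below all thresholds. *)
Lemma dyadic_layer_cake (R : realFieldType) (x : R) I : x <= 2 ^+ I ->
  x <= 2^-1 + \sum_(i < I.+1) (if 2 ^+ i / 2 < x then 2 ^+ i else 0).
Proof.
elim: I => [|I IH] xI.
  rewrite big_ord_recl big_ord0 expr0 addr0.
  by rewrite expr0 in xI; case: ifPn => h; lra.
rewrite big_ord_recr /=; case: ifPn => [h|].
  have : 0 <= \sum_(i < I.+1) (if 2 ^+ i / 2 < x then 2 ^+ i else 0) :> R.
    by apply: sumr_ge0 => i _; case: ifP.
  lra.
rewrite addr0 -leNgt exprS => h; apply: IH; lra.
Qed.

Section Discretization.
Context (R : realType) (G K : finType) (e : K -> G -> complex R).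
Hypothesis e_le1 : forall k g, normc (e k g) <= 1.
Hypothesis parseval : forall c : K -> complex R,
  \sum_g normc (\sum_k c k * e k g) ^+ 2 = #|G|%:R * \sum_k normc (c k) ^+ 2.

(** An atom is a character times a fourth root of unity, so that complex coefficients become
    nonnegative weights. [None] stands for the zero atom, which takes up the mass left over. This
    makes 4|K| + 1 atoms, the base of the union bound. *)
Let Om := option (K * bool * bool).

Let atom (o : Om) (g : G) : complex R :=
  if o is Some (k, b, s) then (-1) ^+ s * 'i%C ^+ b * e k g else 0.

Let normc_atom o g : normc (atom o g) <= 1.
Proof.
case: o => [[[k b] s]|]; last by rewrite /atom normc0.
rewrite /atom.
rewrite !normcM [X in _ * X * _](_ : _ = 1) ?[X in X * _ * _](_ : _ = 1);
  rewrite ?mul1r //.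
  by case: s; rewrite ?expr1 ?expr0 ?normcN normc1.
by case: b; rewrite ?expr1 ?expr0 ?normc1 //= expr0n expr1n add0r sqrtr1.
Qed.

(** The cut lies between the two values compared later: the rescaled polynomial exceeds [8 * u * L]
    on its own level set, the approximation errs by at most [2 * u * L], and a good point of this
    set therefore gives back [4 * u * L]. *)
Let level L (u : R) (o : {ffun 'I_L -> Om}) : {set G} :=
  [set g | 6 * u * L%:R < normc (\sum_l atom (o l) g)].

Let pospart (x : R) (s : bool) : R := Num.max ((-1) ^+ s * x) 0.

Let pospart_ge0 x s : 0 <= pospart x s.
Proof. by rewrite /pospart le_max lexx orbT. Qed.

Let sum_pospart x : pospart x true + pospart x false = `|x|.
Proof.
rewrite /pospart expr0 expr1 mul1r mulN1r.
case: (ger0P x) => h; rewrite ?(max_l (ltW h)); first last.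
  by rewrite max_l ?max_r ?addr0 // ?oppr_ge0 ltW.
by rewrite max_r ?max_l ?add0r // oppr_le0.
Qed.

Let diff_pospart x : - pospart x true + pospart x false = x.
Proof.
rewrite /pospart expr0 expr1 mul1r mulN1r.
case: (ger0P x) => h.
  by rewrite max_r ?max_l ?oppr0 ?add0r // oppr_le0.
by rewrite max_l ?max_r ?addr0 ?opprK // ?oppr_ge0 ltW.
Qed.

(** The mean of the atoms under these weights is the polynomial divided by [B]. They are probability
    weights as soon as [B] dominates the sum of all absolute real and imaginary parts. *)
Let wt (c : K -> complex R) (B : R) (o : Om) : R :=
  if o is Some (k, b, s) then
    pospart (if b then complex.Im (c k) else complex.Re (c k)) s / B
  else 1 - (\sum_k (`|complex.Re (c k)| + `|complex.Im (c k)|)) / B.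

Let sum_Om (V : zmodType) (F : Om -> V) : \sum_o F o =
  F None + \sum_k (F (Some (k, true, true)) + F (Some (k, true, false))
   + (F (Some (k, false, true)) + F (Some (k, false, false)))).
Proof.
rewrite (bigD1 None) //=; congr (_ + _).
rewrite (reindex_omap Some id) /=; last by case.
rewrite (eq_bigl xpredT); last by move=> x; rewrite eqxx.
transitivity (\sum_(p : K * bool * bool) F (Some (p.1.1, p.1.2, p.2))).
  by apply: eq_bigr => -[[]].
rewrite -(pair_bigA _ (fun p s => F (Some (p.1, p.2, s)))) /=.
rewrite -(pair_bigA _ (fun k b => \sum_s F (Some (k, b, s)))) /=.
by apply: eq_bigr => k _; rewrite !big_bool.
Qed.

Let wt_sum1 c B : \sum_o wt c B o = 1.
Proof.
rewrite sum_Om /= mulr_suml -[RHS](subrK (\sum_k (`|complex.Re (c k)|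
  + `|complex.Im (c k)|) / B)); congr (_ + _).
by apply: eq_bigr => k _; rewrite -!mulrDl !sum_pospart addrC.
Qed.

Let wt_atom c B g :
  \sum_o (wt c B o)%:C%C * atom o g = B^-1%:C%C * \sum_k c k * e k g.
Proof.
rewrite sum_Om /= mulr0 add0r mulr_sumr; apply: eq_bigr => k _.
rewrite !expr0 !expr1 !mul1r !mulN1r mulrA !rmorphM /=.
transitivity (B^-1%:C%C * ((- pospart (complex.Re (c k)) true
   + pospart (complex.Re (c k)) false)%:C%C + 'i%C * (- pospart (complex.Im (c k)) true
   + pospart (complex.Im (c k)) false)%:C%C) * e k g).
  rewrite !rmorphD !rmorphN /=; ring.
by rewrite !diff_pospart -complexE.
Qed.

Lemma discretization_of_levels (I s m : nat) (L : 'I_I.+1 -> nat) :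
  (0 < s)%N -> (0 < m)%N -> (0 < #|G|)%N ->
  (s <= 2 ^ I)%N -> (2 ^ I <= 2 * s)%N ->
  let a (i : 'I_I.+1) : R := (4 * I.+1%:R * 2 ^+ i)^-1 in
  (forall i, 8 * expR (- ((L i)%:R * (2 ^+ i / (256 * s%:R)) / 32)) <= a i / 4) ->
  \sum_i (4 * #|K| + 1)%:R ^+ L i * expR (- (a i * m%:R / 4)) < 1 ->
  exists t : 'I_m -> G, forall c : K -> complex R,
    (\sum_k normc (c k)) ^+ 2 <= s%:R * \sum_k normc (c k) ^+ 2 ->
    exists j, \sum_k normc (c k) ^+ 2
      <= 16 * normc (\sum_k c k * e k (t j)) ^+ 2.
Proof.
move=> s0 m0 G0 sI Is a La sum1.
have s0' : 0 < s%:R :> R by rewrite ltr0n.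
have m0' : 0 < m%:R :> R by rewrite ltr0n.
have G0' : 0 < #|G|%:R :> R by rewrite ltr0n.
have p2 i : 0 < 2 ^+ i :> R by rewrite exprn_gt0.
have q0 : 0 < 256 :> R by rewrite ltr0n.
have d0 := mulr_gt0 q0 s0'.
have a0 i : 0 < a i by rewrite invr_gt0 !mulr_gt0.
(* Matched with [B] below: [8 * u i * B] is the square root of [2 ^+ i / 2 * N2], the dyadic
   threshold for the modulus of the polynomial. *)
pose u (i : 'I_I.+1) : R := Num.sqrt (2 ^+ i / (256 * s%:R)).
have usq i : u i ^+ 2 = 2 ^+ i / (256 * s%:R).
  exact: sqr_sqrtr (ltW (divr_gt0 (p2 i) d0)).
have u0 i : 0 < u i by rewrite /u sqrtr_gt0; exact: divr_gt0 (p2 i) d0.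
have L0 i : (0 < L i)%N.
  rewrite lt0n; apply/negP => /eqP Li; have := La i.
  rewrite Li !mul0r oppr0 expR0 mulr1.
  have : a i <= 1.
    rewrite invf_le1 ?mulr_gt0 //.
    have h1 : 1 <= I.+1%:R :> R by rewrite ler1n.
    have h2 : 1 <= 2 ^+ i :> R by rewrite exprn_ege1 // ler1n.
    have := ler_pM ler01 ler01 h1 h2; lra.
  lra.
(* The sample has to hit the level sets of all tuples at all levels, as far as they are dense ([P]).
   None of this depends on [c]. *)
pose T : finType := {i : 'I_I.+1 & {ffun 'I_(L i) -> Om}}.
pose A (x : T) : {set G} := level (u (tag x)) (tagged x).
pose P (x : T) := a (tag x) * #|G|%:R <= #|A x|%:R.
have [|t ht] := @exists_sample R G T P A (fun x => a (tag x)) m G0 (fun x Px => Px).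
  apply: le_lt_trans sum1.
  apply: (@le_trans _ _ (\sum_(x : T) expR (- (a (tag x) * m%:R / 4)))).
    rewrite [leRHS](bigID P) /= lerDl; apply: sumr_ge0 => *; exact: expR_ge0.
  pose F i (_ : {ffun 'I_(L i) -> Om}) : R := expR (- (a i * m%:R / 4)).
  rewrite (eq_bigr (fun x : T => F (tag x) (tagged x))) //.
  rewrite -(sig_big_dep (fun=> true) (fun _ _ => true) F) /=.
  apply: ler_sum => i _; rewrite /F sumr_const card_ffun card_ord.
  rewrite -[leLHS]mulr_natl natrX.
  by rewrite card_option !card_prod card_bool -mulnA mulnC addn1.
exists t => c hc.
set N2 := \sum_k normc (c k) ^+ 2 in hc *.
have N20 : 0 <= N2 by apply: sumr_ge0 => k _; exact: sqr_ge0.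
have [N2z|/eqP N2z] := eqVneq N2 0.
  by exists (Ordinal m0); rewrite N2z mulr_ge0 ?sqr_ge0.
have {N2z}N2p : 0 < N2 by rewrite lt_neqAle eq_sym N20 andbT; apply/eqP.
pose Q g := \sum_k c k * e k g.
pose x g := normc (Q g) ^+ 2 / N2.
(* Effective sparsity bounds the square of the sup norm by [s * N2], so finitely many levels, about
   log s of them, suffice. *)
have xs g : x g <= 2 ^+ I.
  apply: (@le_trans _ _ s%:R); last by rewrite -natrX ler_nat.
  rewrite /x ler_pdivrMr //; apply: le_trans hc.
  rewrite ler_sqr ?nnegrE ?normc_ge0 ?sumr_ge0 //; last by move=> *; exact: normc_ge0.
  apply: le_trans (le_normc_sum _ _ _) _; apply: ler_sum => k _.
  by rewrite normcM ler_piMr ?normc_ge0.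
pose n_ (i : 'I_I.+1) : R := #|[set g | 2 ^+ i / 2 < x g]|%:R.
(* Some dyadic level carries a fraction 1/(2(I+1)) of the mean square. *)
have [i hi] : exists i : 'I_I.+1, 2 * a i * #|G|%:R <= n_ i.
  apply: contrapT => /forallNP H.
  have : \sum_g x g = #|G|%:R.
    by rewrite /x -mulr_suml parseval mulfK // gt_eqF.
  have : \sum_g x g <= \sum_(g : G) (2^-1 +
      \sum_(i < I.+1) (if 2 ^+ i / 2 < x g then 2 ^+ i else 0)).
    by apply: ler_sum => g _; exact: dyadic_layer_cake.
  have sG : \sum_(g : G) 2^-1 = #|G|%:R / 2 :> R by rewrite sumr_const mulr_natl.
  rewrite big_split /= exchange_big /= sG.
  have : (\sum_(i < I.+1) \sum_g (if 2 ^+ i / 2 < x g then 2 ^+ i else 0)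
     < \sum_(i < I.+1) (#|G|%:R / 2 / I.+1%:R) :> R).
    apply: ltr_sum; first by apply/hasP; exists ord0; rewrite ?mem_index_enum.
    move=> i _; rewrite -big_mkcond /= sumr_const -[X in X < _]mulr_natr.
    rewrite [X in _ * X](_ : _ = n_ i); last first.
      by apply/eqP; rewrite eqr_nat; apply/eqP/eq_card => g; rewrite !inE.
    have := H i => /negP; rewrite -ltNge => h.
    apply: (@lt_le_trans _ _ (2 ^+ i * (2 * a i * #|G|%:R))).
      by rewrite ltr_pM2l.
    rewrite /a le_eqVlt; apply/orP; left; apply/eqP; field.
    by rewrite !gt_eqF.
  rewrite sumr_const card_ord -[X in _ < X -> _]mulr_natr divfK ?pnatr_eq0 //.
  move=> h1 h2 h3; rewrite h3 in h2; move: h1 h2; lra.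
(* The factor 2 pays for bounding |Re| + |Im| by sqrt 2 times the modulus. *)
pose B := Num.sqrt (2 * s%:R * N2).
have Bsq : B ^+ 2 = 2 * s%:R * N2 by rewrite sqr_sqrtr // ltW // !mulr_gt0.
have B0 : 0 < B by rewrite sqrtr_gt0 !mulr_gt0.
pose w := wt c B.
have w0 o : 0 <= w o.
  case: o => [[[k b] b']|] /=; first by rewrite divr_ge0 ?pospart_ge0 // ltW.
  rewrite subr_ge0 ler_pdivrMr // mul1r.
  apply: (@le_trans _ _ (Num.sqrt 2 * \sum_k normc (c k))).
    rewrite mulr_sumr; apply: ler_sum => k _.
    rewrite -(@ler_sqr _ _ _) ?nnegrE ?addr_ge0 ?mulr_ge0 ?normc_ge0 //.
    by rewrite exprMn sqr_sqrtr // Re_Im_le_normc.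
  rewrite -(@ler_sqr _ _ _) ?nnegrE ?(ltW B0) ?mulr_ge0 //; last first.
    by apply: sumr_ge0 => k _; exact: normc_ge0.
  by rewrite exprMn sqr_sqrtr // Bsq -mulrA ler_pM2l.
(* Charging the grid and the sample at once yields one approximant that is good
   for both. *)
pose mu g : R := #|G|%:R^-1 + #|[set j | t j == g]|%:R / m%:R.
have mu0 g : 0 <= mu g by rewrite addr_ge0 ?invr_ge0 ?divr_ge0.
have mu_set (S : {set G}) :
  \sum_(g in S) mu g = #|S|%:R / #|G|%:R + #|[set j | t j \in S]|%:R / m%:R.
  rewrite big_split /= sumr_const -[X in X + _]mulr_natl; congr (_ + _).
  rewrite -mulr_suml; congr (_ / _); rewrite -natr_sum; congr (_%:R).
  rewrite -sum1dep_card (partition_big (fun j => t j) (mem S)) //=.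
  apply: eq_bigr => g gS; rewrite -sum1dep_card; apply: eq_bigl => j.
  by case: eqP => [->|]; rewrite ?gS ?andbT ?andbF.
have u04 : 0 <= u i <= 4.
  rewrite (ltW (u0 i)) /= -(@ler_sqr _ (u i)) ?nnegrE ?(ltW (u0 i)) // usq.
  rewrite (ler_pdivrMr _ _ d0).
  have : 2 ^+ i <= 2 ^+ I :> R by rewrite ler_eXn2l ?ltr1n // -ltnS.
  have : 2 ^+ I <= 2 * s%:R :> R by rewrite -natrX -natrM ler_nat.
  lra.
have [om] := @maurey_approximation R Om w w0 (wt_sum1 c B) G
  (fun o g => complex.Re (atom o g)) (fun o g => complex.Im (atom o g))
  mu (L i) (u i)
  (fun o g => le_trans (normr_Re_le _) (normc_atom o g))
  (fun o g => le_trans (normr_Im_le _) (normc_atom o g)) mu0 u04.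
set bad := (X in \sum_(g | X g) _).
have -> : \sum_g mu g = 2.
  have := mu_set [set: G]; rewrite cardsT (eq_bigl xpredT); last first.
    by move=> g; rewrite !inE.
  rewrite (_ : [set j | _] = [set: 'I_m]); last by apply/setP => j; rewrite !inE.
  by rewrite cardsT card_ord !mulfV ?gt_eqF // => ->.
pose bads := [set g | bad g].
rewrite (eq_bigl (mem bads)); last by move=> g; rewrite !inE.
rewrite mu_set usq => hbad.
(* The total mass 2 of [mu] turns the factor 4 of [maurey_approximation] into the 8 of [La].
   Dropping either part of [mu] then bounds the bad fraction of the grid or of the sample by
   [a i / 4]. *)
have eps : 4 * expR (- ((L i)%:R * (2 ^+ i / (256 * s%:R)) / 32)) * 2 <= a i / 4.
  by have := La i; lra.
have badG : #|bads|%:R <= a i / 4 * #|G|%:R.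
  rewrite -ler_pdivrMr //; apply: le_trans eps; apply: le_trans hbad.
  by rewrite lerDl divr_ge0.
have badm : #|[set j | t j \in bads]|%:R <= a i / 4 * m%:R.
  rewrite -ler_pdivrMr //; apply: le_trans eps; apply: le_trans hbad.
  by rewrite lerDr divr_ge0.
have L0' : 0 < (L i)%:R :> R by rewrite ltr0n.
have close g : g \notin bads -> normc (\sum_l atom (om l) g
    - (L i)%:R%:C%C * (B^-1%:C%C * Q g)) <= 2 * u i * (L i)%:R.
  rewrite inE /bad negb_or -!ltNge => /andP[h1 h2].
  rewrite -wt_atom; apply: le_trans (normc_le_Re_Im _) _.
  have -> : 2 * u i * (L i)%:R = (L i)%:R * u i + (L i)%:R * u i by ring.
  apply: lerD; apply/ltW.
    rewrite sumrB sumr_const card_ord -[X in _ - X]mulr_natl in h1.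
    rewrite raddfB /= Re_realM !Re_sum.
    rewrite [X in _ * X](eq_bigr (fun o => w o * complex.Re (atom o g))) //.
    by move=> o _; rewrite Re_realM.
  rewrite sumrB sumr_const card_ord -[X in _ - X]mulr_natl in h2.
  rewrite raddfB /= Im_realM !Im_sum.
  rewrite [X in _ * X](eq_bigr (fun o => w o * complex.Im (atom o g))) //.
  by move=> o _; rewrite Im_realM.
have normv g : normc ((L i)%:R%:C%C * (B^-1%:C%C * Q g)) = (L i)%:R * normc (Q g) / B.
  rewrite !normcM !normc_real !ger0_norm ?invr_ge0 ?(ltW B0) //; ring.
have u64 : (8 * u i * B) ^+ 2 = 2 ^+ i / 2 * N2.
  rewrite !exprMn usq Bsq; field; by rewrite gt_eqF.
(* The dyadic level set has density at least [2 * a i]; without the bad points it still has density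
   [a i], and it lies in the level set of the mean, which is thus one of the sets that the sample
   hits. *)
have PA : P (Tagged _ om).
  rewrite /P /A /=.
  have sub : [set g | 2 ^+ i / 2 < x g] :\: bads \subset level (u i) om.
    apply/fintype.subsetP => g; rewrite !inE => /andP[gb].
    rewrite /x ltr_pdivlMr // -u64 ltr_sqr ?nnegrE ?normc_ge0 ?mulr_ge0 ?(ltW B0) ?(ltW (u0 _)) //.
    move=> hQ; have := close g; rewrite inE => /(_ gb) hc1.
    have := le_normcD (\sum_l atom (om l) g) (- (\sum_l atom (om l) g
       - (L i)%:R%:C%C * (B^-1%:C%C * Q g))).
    rewrite opprB addrC subrK normv -opprB normcN => hc2.
    have : 8 * u i * (L i)%:R < (L i)%:R * normc (Q g) / B.
      by rewrite ltr_pdivlMr // mulrAC mulrC ltr_pM2l.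
    lra.
  have := subset_leq_card sub; rewrite -(ler_nat R) => /(le_trans _); apply.
  rewrite cardsD natrB ?subset_leq_card ?subsetIl //.
  have : #|[set g | 2 ^+ i / 2 < x g] :&: bads|%:R <= #|bads|%:R :> R.
    by rewrite ler_nat subset_leq_card // subsetIr.
  have aG : 0 <= a i * #|G|%:R by rewrite mulr_ge0 // ltW.
  move: hi; rewrite /n_; lra.
have := ht _ PA; rewrite /A /= => hcount.
(* More than [a i * m / 4] sample points hit the level set and at most that many are bad. *)
have [j] : exists j, (t j \in level (u i) om) && (t j \notin bads).
  apply/existsP; apply: contraTT hcount; rewrite negb_exists => /forallP H.
  rewrite -leNgt; apply: le_trans (_ : #|[set j | t j \in bads]|%:R <= _); last first.
    by apply: le_trans badm _; lra.
  rewrite ler_nat subset_leq_card //; apply/fintype.subsetP => j; rewrite !inE => h.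
  by have := H j; rewrite !inE h /= negbK.
rewrite inE => /andP[hl /close hc1]; exists j.
have := le_normcD (\sum_l atom (om l) (t j)
   - (L i)%:R%:C%C * (B^-1%:C%C * Q (t j))) ((L i)%:R%:C%C * (B^-1%:C%C * Q (t j))).
rewrite subrK normv => hc2.
have : 4 * u i * (L i)%:R < (L i)%:R * normc (Q (t j)) / B by lra.
rewrite ltr_pdivlMr // mulrAC mulrC ltr_pM2l // => hc3.
have : (4 * u i * B) ^+ 2 <= normc (Q (t j)) ^+ 2.
  by rewrite ler_sqr ?nnegrE ?normc_ge0 ?(ltW hc3) // !mulr_ge0 // ltW.
(* This square equals [2 ^+ i * N2 / 8], hence is at least [N2 / 8]. *)
have -> : (4 * u i * B) ^+ 2 = (8 * u i * B) ^+ 2 / 4 by field.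
rewrite u64 -/(Q (t j)).
have : N2 <= 2 ^+ i * N2 by rewrite ler_peMl // exprn_ege1 // ler1n.
lra.
Qed.

End Discretization.

(** * Choice of the number of levels and of the tuple lengths *)

Lemma half_le_ln2 (R : realType) : 2^-1 <= ln 2 :> R.
Proof.
rewrite -ler_expR lnK ?posrE //.
have h : 2^-1 <= expR (- 2^-1) :> R.
  by apply: le_trans (expR_ge1Dx _); lra.
by rewrite -lef_pV2 ?posrE ?expR_gt0 // -expRN.
Qed.

Lemma half_le_ln (R : realType) (n : nat) : (1 < n)%N -> 2^-1 <= ln n%:R :> R.
Proof.
move=> n1; apply: le_trans (half_le_ln2 R) _.
by rewrite ler_ln ?posrE ?ltr0n ?ler_nat // (ltn_trans _ n1).
Qed.

(** The factors come from [level_parameters]: 16 is the product of the two 4s in [a i * m / 4], 6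
    bounds the number of levels and 10 bounds [Lam], both relative to [ln s.+1], and [32 * 256 + 4]
    comes from the tuple lengths. *)
Definition discretization_constant (R : pzRingType) : R :=
  16 * 6 * (10 * (32 * 256 + 4)).

Lemma level_parameters (R : realType) (s N m : nat) : (0 < s)%N -> (0 < N)%N ->
  discretization_constant R * s%:R * ln s.+1%:R ^+ 2 * ln (4 * N + 1)%:R <= m%:R ->
  exists I (L : 'I_I.+1 -> nat),
  [/\ (s <= 2 ^ I)%N, (2 ^ I <= 2 * s)%N,
   (forall i, 8 * expR (- ((L i)%:R * (2 ^+ i / (256 * s%:R)) / 32))
      <= (4 * I.+1%:R * 2 ^+ i)^-1 / 4 :> R) &
  \sum_i (4 * N + 1)%:R ^+ L i * expR (- ((4 * I.+1%:R * 2 ^+ i)^-1 * m%:R / 4))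
     < 1 :> R].
Proof.
move=> s0 N0 hm.
(* Naming the numeral keeps unification from unfolding it. *)
have [q qE] : exists q : R, q = 256 by exists 256.
rewrite /discretization_constant -!qE in hm *.
have q0 : 0 < q by rewrite qE ltr0n.
have s0' : 0 < s%:R :> R by rewrite ltr0n.
have s1 : 1 <= s%:R :> R by rewrite ler1n.
have [tl1 tl2] := (trunc_logP (isT : (1 < 2)%N) s0, trunc_log_ltn s (isT : (1 < 2)%N)).
pose I := (trunc_log 2 s).+1.
have sI : (s <= 2 ^ I)%N by exact: ltnW.
have Is : (2 ^ I <= 2 * s)%N by rewrite expnS leq_mul2l.
have p2 i : 0 < 2 ^+ i :> R by rewrite exprn_gt0.
have p2s (i : 'I_I.+1) : 2 ^+ i <= 2 * s%:R :> R.
  apply: (@le_trans _ _ (2 ^+ I)); first by rewrite ler_eXn2l ?ltr1n // -ltnS.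
  by rewrite -natrX -natrM ler_nat.
set lam := ln s.+1%:R in hm.
have lam_half : 2^-1 <= lam by exact: half_le_ln.
have lns : 0 <= ln (s%:R : R) <= lam.
  apply/andP; split; first exact: ln_ge0.
  by rewrite ler_ln ?posrE ?ltr0n // ler_nat.
pose l : R := I.+1%:R.
have l0 : 0 < l by rewrite ltr0n.
have l1 : 1 <= l by rewrite ler1n.
have llam : l <= 6 * lam.
  have : (trunc_log 2 s)%:R * ln 2 <= lam.
    apply: le_trans (proj2 (andP lns)).
    by rewrite mulr_natl -lnXn // -natrX ler_ln ?posrE ?ltr0n ?expn_gt0 // ler_nat.
  have := half_le_ln2 R; have : 0 <= (trunc_log 2 s)%:R :> R by [].
  rewrite /l /I => h1 h2 h3; rewrite -natr1 -[X in X + 1]natr1.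
  have := ler_wpM2l h1 h2; lra.
have lnl : 0 <= ln l <= lam.
  apply/andP; split; first exact: ln_ge0.
  rewrite ler_ln ?posrE ?ltr0n // ler_nat /I !ltnS.
  apply: leq_trans tl1; exact: ltn_expl.
(* With this choice [8 * expR (- Lam)] is 1/(32 l s), which is at most a quarter of the density 1/(4
   l 2^i) because 2^i is at most 2s. *)
pose Lam : R := ln (q * l * s%:R).
have lnq : ln q = 8 * ln 2.
  by rewrite (_ : q = 2 ^+ 8) ?lnXn ?mulr_natl // qE; ring.
have LamE : Lam = 8 * ln 2 + ln l + ln s%:R.
  by rewrite /Lam lnM ?posrE ?(mulr_gt0 q0 l0) // lnM ?posrE // lnq.
have ln2lam : ln 2 <= lam by rewrite ler_ln ?posrE ?ltr0n // ler_nat ltnS.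
have Lam1 : 1 <= Lam.
  by have := half_le_ln2 R; rewrite LamE; move: lns lnl => /andP[? _] /andP[? _]; lra.
have Lamlam : Lam <= 10 * lam.
  by rewrite LamE; move: lns lnl => /andP[_ ?] /andP[_ ?]; lra.
set W := (4 * N + 1)%N in hm *.
have W0 : 0 < W%:R :> R by rewrite ltr0n /W addn1.
have lnW : 1 <= ln W%:R :> R.
  apply: (@le_trans _ _ (ln (2 ^+ 2))).
    by rewrite lnXn // mulr2n; have := half_le_ln2 R; lra.
  rewrite ler_ln ?posrE ?exprn_gt0 // -natrX ler_nat /W.
  by case: N N0 {hm W W0} => // N _; rewrite mulnS -addnA leq_addr.
(* The length at which the tail exponent reaches [Lam]. It is proportional to 2^(-i), as is the
   density, so the condition on [m] will not depend on the level. *)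
pose y (i : 'I_I.+1) : R := 32 * (q * s%:R / 2 ^+ i) * Lam.
have y0 i : 0 <= y i by rewrite !mulr_ge0 ?invr_ge0 ?(ltW q0) ?(ltW (p2 _)) // (le_trans ler01).
pose L i := (Num.truncn (y i)).+1.
have Ly i : y i <= (L i)%:R <= y i + 1.
  have /andP[h1 h2] := truncn_itv (y0 i).
  by rewrite ltW //= /L -natr1 lerD2r.
exists I, L; split => //.
- move=> i.
  have h : Lam <= (L i)%:R * (2 ^+ i / (q * s%:R)) / 32.
    have /andP[h1 _] := Ly i.
    rewrite -mulrA -ler_pdivrMr; last by rewrite !divr_gt0 // mulr_gt0.
    apply: le_trans h1; rewrite /y le_eqVlt; apply/orP; left; apply/eqP.
    by field; rewrite !gt_eqF.
  apply: (@le_trans _ _ (8 * expR (- Lam))).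
    by rewrite ler_pM2l // ler_expR lerN2.
  rewrite expRN /Lam lnK ?posrE ?mulr_gt0 // -/l.
  rewrite -[_ / 4]invfM -[8]invrK -invfM lef_pV2 ?posrE ?mulr_gt0 ?invr_gt0 //.
  have := ler_wpM2l (ltW l0) (p2s i); rewrite qE; lra.
rewrite -/l.
(* Each of the [l] levels may use up 1/(2l), for a total of 1/2. *)
apply: (@le_lt_trans _ _ (\sum_(i < I.+1) (2 * l)^-1)); last first.
  rewrite sumr_const card_ord -[X in X < _]mulr_natl -/l invfM mulrCA mulfV ?gt_eqF //; lra.
apply: ler_sum => i _.
rewrite -[W%:R]lnK ?posrE // -expRM_natl -expRD.
rewrite -[leRHS]lnK ?posrE ?invr_gt0 ?mulr_gt0 // ler_expR lnV ?posrE ?mulr_gt0 //.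
have -> : (4 * l * 2 ^+ i)^-1 * m%:R / 4 = m%:R / (16 * l * 2 ^+ i).
  by field; rewrite !gt_eqF.
rewrite lerBlDr -lerBlDl opprK addrC ler_pdivlMr ?mulr_gt0 //.
have d0 : 0 < 16 * l * 2 ^+ i by rewrite !mulr_gt0.
apply: le_trans hm.
set w := ln W%:R in lnW *.
have ln2l : ln (2 * l) <= Lam.
  rewrite ler_ln ?posrE ?mulr_gt0 //.
  have : l <= l * s%:R by rewrite ler_peMr // ltW.
  by rewrite qE; lra.
have Ll : 2 ^+ i * (L i)%:R <= (32 * q + 2) * s%:R * Lam.
  have /andP[_ h] := Ly i.
  apply: le_trans (ler_wpM2l (ltW (p2 i)) h) _.
  have -> : 2 ^+ i * (y i + 1) = 32 * q * (s%:R * Lam) + 2 ^+ i.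
    by rewrite /y; field; rewrite gt_eqF.
  have := p2s i; have := ler_wpM2l (ltW s0') Lam1; lra.
have step1 : 2 ^+ i * ((L i)%:R * w + ln (2 * l)) <= (32 * q + 4) * s%:R * Lam * w.
  have w0 : 0 <= w by apply: le_trans lnW.
  have Lam0 : 0 <= Lam by apply: le_trans Lam1.
  have h1 := ler_wpM2r w0 Ll.
  have h2 : 2 ^+ i * ln (2 * l) <= 2 * s%:R * (Lam * w).
    apply: ler_pM (ltW (p2 i)) _ (p2s i) _; first by apply: ln_ge0; lra.
    by apply: le_trans ln2l _; rewrite ler_peMr.
  lra.
have leE (z z' : R) : z = z' -> z <= z' by move=> ->.
apply: (@le_trans _ _ (16 * l * (2 ^+ i * ((L i)%:R * w + ln (2 * l))))).
  by apply: leE; ring.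
apply: (@le_trans _ _ (16 * (6 * lam) * ((32 * q + 4) * s%:R * (10 * lam) * w))).
  have w0 : 0 <= w by apply: le_trans lnW.
  have Lam0 : 0 <= Lam by apply: le_trans Lam1.
  apply: ler_pM; rewrite ?mulr_ge0 // ?(ltW l0) ?(ltW (p2 _)) //.
  - by apply: addr_ge0; [rewrite mulr_ge0|apply: ln_ge0; lra].
  - by rewrite ler_pM2l.
  - apply: le_trans step1 _; apply: ler_wpM2r => //; apply: ler_wpM2l => //.
    by apply: mulr_ge0; [lra|exact: ltW].
by apply: leE; ring.
Qed.

(* One-sided restricted isometry for effectively sparse coefficients, with the
   maximum over the sample in place of its mean square. *)
Lemma exists_discretizing_sample (R : realType) (G K : finType)
    (e : K -> G -> complex R) (s m : nat) :
  (forall k g, normc (e k g) <= 1) ->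
  (forall c : K -> complex R,
    \sum_g normc (\sum_k c k * e k g) ^+ 2 = #|G|%:R * \sum_k normc (c k) ^+ 2) ->
  (0 < #|G|)%N -> (0 < #|K|)%N -> (0 < s)%N ->
  discretization_constant R * s%:R * ln s.+1%:R ^+ 2 * ln (4 * #|K| + 1)%:R
    <= m%:R ->
  exists t : 'I_m -> G, forall c : K -> complex R,
    (\sum_k normc (c k)) ^+ 2 <= s%:R * \sum_k normc (c k) ^+ 2 ->
    exists j, \sum_k normc (c k) ^+ 2
      <= 16 * normc (\sum_k c k * e k (t j)) ^+ 2.
Proof.
move=> e1 parseval G0 K0 s0 hm.
have m0 : (0 < m)%N.
  rewrite -(ltr0n R); apply: lt_le_trans hm.
  have h1 : 0 < ln s.+1%:R :> R by apply: lt_le_trans (half_le_ln _ _); rewrite ?ltnS ?invr_gt0.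
  have h2 : 0 < ln (4 * #|K| + 1)%:R :> R.
    apply: lt_le_trans (half_le_ln _ _); first by lra.
    by rewrite addn1 ltnS muln_gt0.
  by rewrite !mulr_gt0 ?exprn_gt0 ?ltr0n // /discretization_constant; lra.
have [I [L [sI Is La sum1]]] := level_parameters s0 K0 hm.
exact: (discretization_of_levels e1 parseval s0 m0 G0 sI Is La sum1).
Qed.

Local Open Scope classical_set_scope.
Local Open Scope ring_scope.

(** * Integration on the torus *)

Section PowerIntegrals.
Context (R : realType).

Lemma bounded_integrable_prob dd (T : measurableType dd) (P : probability T R)
    (f : T -> R) (M : R) :
  measurable_fun [set: T] f -> (forall x, `|f x| <= M) ->
  P.-integrable [set: T] (EFin \o f).
Proof.
move=> mf fM; apply: measurable_bounded_integrable => //.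
  by apply: (@le_lt_trans _ _ 1%E); [exact: probability_le1|exact: ltry].
by exists M; split; [exact: num_real|move=> x Mx y _; exact: le_trans (fM y) (ltW Mx)].
Qed.

Lemma Rintegral_cst_prob dd (T : measurableType dd) (P : probability T R) (r : R) :
  \int[P]_x r = r.
Proof.
rewrite Rintegral_cst // -[RHS]mulr1; congr (_ * _).
exact: (congr1 fine (probability_setT P)).
Qed.

Context dd (T : measurableType dd) (P : probability T R).

Lemma power_prob_integral n (f : n.+1.-tuple T -> R) (M : R) :
  measurable_fun setT f -> (forall x, `|f x| <= M) ->
  \int[power_prob P n.+1]_x f x
    = \int[P]_x \int[power_prob P n]_y f (tuple_cons (x, y)).
Proof.
move=> mf fM.
have mg : measurable_fun setT (fun xy : T * n.-tuple T => f (tuple_cons xy)).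
  by apply: measurableT_comp => //; exact: measurable_tuple_cons.
have ig : (prod_prob P (power_prob P n)).-integrable setT
    (EFin \o (fun xy : T * n.-tuple T => f (tuple_cons xy))).
  by apply: bounded_integrable_prob mg _ => x; exact: fM.
rewrite {1}/Rintegral /= integral_distribution //; last first.
  exact/measurable_EFinP.
rewrite /Rintegral; congr fine.
rewrite -[LHS]/(\int[(P \x power_prob P n)]_x
   (EFin \o (fun xy : T * n.-tuple T => f (tuple_cons xy))) x)%E.
rewrite -integral12_prod_meas1 //.
apply: eq_integral => x _; rewrite /fubini_F /= fineK //.
apply: integrable_fin_num => //.
apply: (@bounded_integrable_prob _ _ (power_prob P n) (fun y => f (tuple_cons (x, y))) M) => //.
by apply: measurableT_comp mg _; exact: pair1_measurable.
Qed.

Lemma tnth_tuple_cons0 n (x : T) (y : n.-tuple T) :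
  tnth (tuple_cons (x, y)) ord0 = x.
Proof. by rewrite (tnth_nth x). Qed.

Lemma tnth_tuple_consS n (x : T) (y : n.-tuple T) i :
  tnth (tuple_cons (x, y)) (lift ord0 i) = tnth y i.
Proof. by rewrite !(tnth_nth x). Qed.

Lemma power_prob_integral_prod n (g : 'I_n -> T -> R) :
  (forall i, measurable_fun setT (g i)) -> (forall i x, 0 <= g i x <= 1) ->
  \int[power_prob P n]_y \prod_i g i (tnth y i) = \prod_i \int[P]_x g i x.
Proof.
elim: n g => [|n IH] g mg g01.
  rewrite big_ord0 -[RHS](Rintegral_cst_prob (power_prob P 0)).
  by apply: eq_Rintegral => y _; rewrite big_ord0.
have gn1 i x : `|g i x| <= 1.
  by case/andP: (g01 i x) => h1 h2; rewrite ger0_norm.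
rewrite (@power_prob_integral n _ 1); first last.
- move=> x; rewrite normr_prod; apply: prodr_ile1 => i _.
  by rewrite normr_ge0 gn1.
- apply: measurable_prod => i _; apply: measurableT_comp => //.
  exact: measurable_tnth.
rewrite big_ord_recl -(IH (fun i => g (lift ord0 i))) //.
have h y : (\int[power_prob P n]_z \prod_i g i (tnth (tuple_cons (y, z)) i)
  = g ord0 y * \int[power_prob P n]_z \prod_(i < n) g (lift ord0 i) (tnth z i))%R.
  rewrite -RintegralZl //; last first.
    apply: (@bounded_integrable_prob _ _ _ _ 1).
      apply: measurable_prod => i _; apply: measurableT_comp => //.
      exact: measurable_tnth.
    move=> x; rewrite normr_prod; apply: prodr_ile1 => i _.
    by rewrite normr_ge0 gn1.
  apply: eq_Rintegral => z _; rewrite big_ord_recl tnth_tuple_cons0.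
  by congr (_ * _); apply: eq_bigr => i _; rewrite tnth_tuple_consS.
under eq_Rintegral do rewrite h.
rewrite RintegralZr //.
exact: (@bounded_integrable_prob _ _ _ _ 1).
Qed.

End PowerIntegrals.

(** * Integrals of cosines over the torus *)

Section TorusIntegrals.
Context (R : realType).

Lemma cosD2piz (x : R) (k : int) : cos (x + 2 * pi * k%:~R) = cos x.
Proof.
have h n y : cos (y + 2 * pi * n%:R) = cos y :> R.
  rewrite -[RHS](periodicn (@cosD2pi R) n); congr (cos (_ + _)).
  by rewrite -[RHS]mulr_natr mulr2n; ring.
case: k => n; first exact: h.
by rewrite -[LHS](h n.+1) NegzE mulrNz mulrN subrK.
Qed.

Lemma sinD2piz (x : R) (k : int) : sin (x + 2 * pi * k%:~R) = sin x.
Proof.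
have h n y : sin (y + 2 * pi * n%:R) = sin y :> R.
  rewrite -[RHS](periodicn (@sinD2pi R) n); congr (sin (_ + _)).
  by rewrite -[RHS]mulr_natr mulr2n; ring.
case: k => n; first exact: h.
by rewrite -[LHS](h n.+1) NegzE mulrNz mulrN subrK.
Qed.
Local Notation unif := (uniform_prob (@ltr01 R)).

Lemma measurable_cos_affine (a b : R) :
  measurable_fun setT (fun x : R => cos (a * x + b)).
Proof.
apply: measurableT_comp; first by apply: continuous_measurable_fun; exact: continuous_cos.
by apply: measurable_funD => //; exact: measurable_funM.
Qed.

Lemma integral_cos_affine (k : int) (th : R) :
  \int[unif]_x cos (2 * pi * k%:~R * x + th) = if k == 0 then cos th else 0.
Proof.
case: eqP => [->|/eqP k0].
  under eq_Rintegral do rewrite mulr0 mul0r add0r.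
  by rewrite Rintegral_cst_prob.
set a := 2 * pi * k%:~R.
have a0 : a != 0.
  by rewrite /a !mulf_neq0 ?pnatr_eq0 ?intr_eq0 ?(gt_eqF (pi_gt0 R)).
have caff : continuous (fun x : R => a * x + th).
  by move=> x; apply: cvgD; [apply: cvgMl_tmp; exact: cvg_id|exact: cvg_cst].
(* [integral_uniform] is applied to a nonnegative integrand, hence the shift by 1. *)
have int1 : \int[unif]_x (1 + cos (a * x + th)) = 1.
  rewrite /Rintegral integral_uniform; first last.
  - by move=> x; rewrite lee_fin; have := cos_geN1 (a * x + th); lra.
  - apply/measurable_EFinP; apply: measurable_funD => //; exact: measurable_cos_affine.
  rewrite subr0 invr1 mul1e.
  pose F (x : R) := x + sin (a * x + th) / a.
  have dF (x : R) : is_derive x (1 : R) F (1 + cos (a * x + th)).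
    have h : is_derive x (1 : R) (sin \o (fun y : R => a * y + th)) (cos (a * x + th) * a).
      apply: is_derive1_comp.
      have : is_derive x (1 : R) ((a \*: id) + cst th) (a *: 1 + 0) by exact: is_deriveD.
      by move=> /is_derive_eq; apply; rewrite addr0 /GRing.scale /= mulr1.
    have -> : F = id + (a^-1 \*: (sin \o (fun y : R => a * y + th))).
      by apply/funext => y; rewrite /F /= mulrC.
    apply: is_derive_eq; rewrite /GRing.scale /=.
    by congr (1 + _); rewrite mulrC mulfK.
  have cF : continuous F.
    move=> x; have [dx _] := dF x.
    exact/differentiable_continuous/derivable1_diffP.
  rewrite (@continuous_FTC2 _ _ F) //.
  - rewrite -EFinB /= /F mulr1 mulr0 !add0r.
    by rewrite [a + th]addrC sinD2piz addrK.
  - apply: continuous_subspaceT => x; apply: cvgD; first exact: cvg_cst.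
    by apply: continuous_comp; [exact: caff|exact: continuous_cos].
  - split => [x _||]; first by case: (dF x).
      exact/cvg_at_right_filter/cF.
    exact/cvg_at_left_filter/cF.
  - by move=> x _; rewrite derive1E; case: (dF x).
have : \int[unif]_x (1 + cos (a * x + th)) = 1 + \int[unif]_x cos (a * x + th).
  rewrite RintegralD //.
  - by rewrite Rintegral_cst_prob.
  - by apply: (@bounded_integrable_prob _ _ _ _ _ 1) => // x; rewrite normr1.
  - apply: (@bounded_integrable_prob _ _ _ _ _ 1); first exact: measurable_cos_affine.
    by move=> x; rewrite ler_norml cos_geN1 cos_le1.
by rewrite int1 -[X in X = _]addr0 => /addrI.
Qed.

Lemma pairing_cons d (k : d.+1.-tuple int) (x : R) (y : d.-tuple R) :
  pairing k (tuple_cons (x, y)) =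
  (tnth k ord0)%:~R * x + pairing [tuple of behead k] y.
Proof.
rewrite /pairing big_ord_recl tnth_tuple_cons0; congr (_ + _).
apply: eq_bigr => i _; rewrite tnth_tuple_consS; congr (_%:~R * _).
by rewrite !(tnth_nth 0) /= nth_behead.
Qed.

Lemma measurable_pairing d (k : d.-tuple int) :
  measurable_fun [set: torus_pt R d] (pairing k : _ -> measurableTypeR R).
Proof.
apply: measurable_sum => i; apply: measurable_funM => //.
exact: measurable_tnth.
Qed.

Lemma measurable_cos_pairing d (k : d.-tuple int) (th : R) :
  measurable_fun [set: torus_pt R d]
    (fun x => cos (2 * pi * pairing k x + th) : measurableTypeR R).
Proof.
apply: measurableT_comp; first by apply: continuous_measurable_fun; exact: continuous_cos.
apply: measurable_funD => //; apply: measurable_funM => //.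
exact: measurable_pairing.
Qed.

Lemma cos_pairing_le1 d (k : d.-tuple int) (th : R) (x : torus_pt R d) :
  `|cos (2 * pi * pairing k x + th)| <= 1.
Proof. by rewrite ler_norml cos_geN1 cos_le1. Qed.

(** The phase [th] makes the induction on [d] work, since it absorbs the first coordinate; the value
    [- (pi / 2)] later yields the sine. *)
Lemma integral_cos_pairing d (k : d.-tuple int) (th : R) :
  \int[haar R d]_x cos (2 * pi * pairing k x + th)
    = if [forall i, tnth k i == 0] then cos th else 0.
Proof.
elim: d k th => [|d IH] k th.
  rewrite ifT; last by apply/forallP => -[].
  rewrite -[RHS](Rintegral_cst_prob (haar R 0)); apply: eq_Rintegral => x _.
  by rewrite /pairing big_ord0 mulr0 add0r.
rewrite (@power_prob_integral _ _ _ _ _ _ 1); first last.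
- by move=> x; exact: cos_pairing_le1.
- exact: measurable_cos_pairing.
pose k' := [tuple of behead k].
have h (x : R) : \int[haar R d]_y cos (2 * pi * pairing k (tuple_cons (x, y)) + th)
   = if [forall i, tnth k' i == 0] then cos (2 * pi * (tnth k ord0)%:~R * x + th) else 0.
  rewrite -IH; apply: eq_Rintegral => y _; congr cos.
  by rewrite pairing_cons; ring.
transitivity (\int[unif]_x (if [forall i, tnth k' i == 0]
    then cos (2 * pi * (tnth k ord0)%:~R * x + th) else 0)).
  by apply: eq_Rintegral => x _; exact: h.
have kE : [forall i, tnth k i == 0]
    = (tnth k ord0 == 0) && [forall i, tnth k' i == 0].
  have tk' i : tnth k' i = tnth k (lift ord0 i).
    by rewrite !(tnth_nth 0) /= nth_behead.
  apply/forallP/andP => [H|[H0 /forallP H] i].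
    by split; [exact: H|apply/forallP => i; rewrite tk'].
  by case: (unliftP ord0 i) => [j|] ->; [rewrite -tk'|].
rewrite kE; case: [forall i, tnth k' i == 0]; rewrite ?andbT ?andbF /=.
  exact: integral_cos_affine.
exact: Rintegral_cst_prob.
Qed.

End TorusIntegrals.

Section ComplexIntegrals.
Context (R : realType) (d : nat).
Local Notation pt := (torus_pt R d).
Local Notation mu := (haar R d).
Implicit Types (f g h : pt -> complex R) (c : complex R).

Lemma Re_mulc (z w : complex R) : complex.Re (z * w) =
  complex.Re z * complex.Re w - complex.Im z * complex.Im w.
Proof. by case: z w => [? ?] [? ?]. Qed.

Lemma Im_mulc (z w : complex R) : complex.Im (z * w) =
  complex.Re z * complex.Im w + complex.Im z * complex.Re w.
Proof. by case: z w => [? ?] [? ?]. Qed.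

Lemma complex_eqP (z w : complex R) :
  complex.Re z = complex.Re w -> complex.Im z = complex.Im w -> z = w.
Proof. by case: z w => [? ?] [? ?] /= -> ->. Qed.

Lemma measurable_torusD f g : measurable_torus f -> measurable_torus g ->
  measurable_torus (fun x => f x + g x).
Proof.
move=> [fR fI] [gR gI]; split.
  rewrite (_ : (fun x => _) = (fun x => complex.Re (f x) + complex.Re (g x)));
    last by apply/funext => x; rewrite raddfD.
  exact: measurable_funD.
rewrite (_ : (fun x => _) = (fun x => complex.Im (f x) + complex.Im (g x)));
  last by apply/funext => x; rewrite raddfD.
exact: measurable_funD.
Qed.

Lemma measurable_torus_cst c : measurable_torus (fun _ : pt => c).
Proof. by split; exact: measurable_cst. Qed.

Lemma measurable_torusM f g : measurable_torus f -> measurable_torus g ->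
  measurable_torus (fun x => f x * g x).
Proof.
move=> [fR fI] [gR gI]; split.
  rewrite (_ : (fun x => _) = (fun x => complex.Re (f x) * complex.Re (g x)
     - complex.Im (f x) * complex.Im (g x)));
    last by apply/funext => x; rewrite Re_mulc.
  by apply: measurable_funB; exact: measurable_funM.
rewrite (_ : (fun x => _) = (fun x => complex.Re (f x) * complex.Im (g x)
   + complex.Im (f x) * complex.Re (g x)));
  last by apply/funext => x; rewrite Im_mulc.
by apply: measurable_funD; exact: measurable_funM.
Qed.

Lemma measurable_torus_sum (I : Type) (s : seq I) (F : I -> pt -> complex R) :
  (forall i, measurable_torus (F i)) ->
  measurable_torus (fun x => \sum_(i <- s) F i x).
Proof.
move=> mF; elim: s => [|i s IH].
  under eq_fun do rewrite big_nil; exact: measurable_torus_cst.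
under eq_fun do rewrite big_cons; exact: measurable_torusD.
Qed.

Lemma integrable_torus_measurable f : integrable_torus f -> measurable_torus f.
Proof.
by move=> [/measurable_int fR /measurable_int fI]; split; exact/measurable_EFinP.
Qed.

Lemma integrable_torus_bounded f (M : R) :
  measurable_torus f -> (forall x, normc (f x) <= M) -> integrable_torus f.
Proof.
move=> [fR fI] fM; split; apply: (@bounded_integrable_prob _ _ _ _ _ M) => // x.
  exact: le_trans (normr_Re_le _) (fM x).
exact: le_trans (normr_Im_le _) (fM x).
Qed.

Lemma integrable_torusD f g : integrable_torus f -> integrable_torus g ->
  integrable_torus (fun x => f x + g x).
Proof.
move=> [fR fI] [gR gI]; split.
  by apply: eq_integrable (integrableD _ fR gR) => // x _; rewrite raddfD.
by apply: eq_integrable (integrableD _ fI gI) => // x _; rewrite raddfD.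
Qed.

Lemma integrable_bounded_mul (u v : pt -> R) (M : R) :
  mu.-integrable setT (EFin \o u) -> measurable_fun setT v ->
  (forall x, `|v x| <= M) -> mu.-integrable setT (fun x => (u x * v x)%:E).
Proof.
move=> iu mv vM; apply: (integrableMl _ iu mv) => //.
by exists M; split; [exact: num_real|move=> x Mx y _; exact: le_trans (vM y) (ltW Mx)].
Qed.

Lemma integrable_torusM f g (M : R) : integrable_torus f ->
  measurable_torus g -> (forall x, normc (g x) <= M) ->
  integrable_torus (fun x => f x * g x).
Proof.
move=> [fR fI] [gR gI] gM.
have gRM x : `|complex.Re (g x)| <= M := le_trans (normr_Re_le _) (gM x).
have gIM x : `|complex.Im (g x)| <= M := le_trans (normr_Im_le _) (gM x).
split.
  apply: eq_integrable (integrableB _ (integrable_bounded_mul fR gR gRM)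
    (integrable_bounded_mul fI gI gIM)) => // x _ /=; by rewrite Re_mulc EFinB.
apply: eq_integrable (integrableD _ (integrable_bounded_mul fR gI gIM)
    (integrable_bounded_mul fI gR gRM)) => // x _ /=; by rewrite Im_mulc EFinD.
Qed.

Lemma integrable_torusZ f c : integrable_torus f ->
  integrable_torus (fun x => c * f x).
Proof.
move=> fi; rewrite (_ : (fun x => _) = (fun x => f x * c)); last first.
  by apply/funext => x; rewrite mulrC.
apply: (@integrable_torusM _ _ (normc c) fi) => //; exact: measurable_torus_cst.
Qed.

Lemma eq_integral_torus f g : f =1 g -> integral_torus f = integral_torus g.
Proof. by move=> /funext ->. Qed.

Lemma integral_torusD f g : integrable_torus f -> integrable_torus g ->
  integral_torus (fun x => f x + g x) = integral_torus f + integral_torus g.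
Proof.
move=> [fR fI] [gR gI]; apply: complex_eqP; rewrite raddfD /= -RintegralD //;
  by apply: eq_Rintegral => x _; rewrite raddfD.
Qed.

Lemma integral_torusZ f c : integrable_torus f ->
  integral_torus (fun x => c * f x) = c * integral_torus f.
Proof.
move=> [fR fI]; have iZ (r : R) (u : pt -> R) : mu.-integrable setT (EFin \o u) ->
    mu.-integrable setT (EFin \o (fun x => r * u x)).
  by move=> iu; apply: eq_integrable (integrableZl _ r iu).
apply: complex_eqP.
  rewrite Re_mulc /= -!RintegralZl // -RintegralB //; try exact: iZ.
  by apply: eq_Rintegral => x _; rewrite Re_mulc.
rewrite Im_mulc /= -!RintegralZl // -RintegralD //; try exact: iZ.
by apply: eq_Rintegral => x _; rewrite Im_mulc.
Qed.

Lemma integral_torus0 : integral_torus (fun _ : pt => 0) = 0 :> complex R.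
Proof. by apply: complex_eqP; rewrite /= Rintegral_cst_prob. Qed.

Lemma integrable_torus_sum (I : Type) (s : seq I) (F : I -> pt -> complex R) :
  (forall i, integrable_torus (F i)) ->
  integrable_torus (fun x => \sum_(i <- s) F i x).
Proof.
move=> iF; elim: s => [|i s IH].
  under eq_fun do rewrite big_nil.
  apply: (@integrable_torus_bounded _ 0); first exact: measurable_torus_cst.
  by move=> x; rewrite normc0.
by under eq_fun do rewrite big_cons; exact: integrable_torusD.
Qed.

Lemma integral_torus_sum (I : Type) (s : seq I) (F : I -> pt -> complex R) :
  (forall i, integrable_torus (F i)) ->
  integral_torus (fun x => \sum_(i <- s) F i x)
    = \sum_(i <- s) integral_torus (F i).
Proof.
move=> iF; elim: s => [|i s IH].
  by rewrite big_nil -[RHS]integral_torus0; apply: eq_integral_torus => x; rewrite big_nil.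
rewrite big_cons -IH -integral_torusD //; last exact: integrable_torus_sum.
by apply: eq_integral_torus => x; rewrite big_cons.
Qed.

End ComplexIntegrals.

(** * Characters and trigonometric polynomials *)

Section Characters.
Context (R : realType) (d : nat).
Local Notation pt := (torus_pt R d).
Local Notation mu := (haar R d).
Implicit Types (k l : d.-tuple int) (x : pt).

Definition addz k l : d.-tuple int := [tuple tnth k i + tnth l i | i < d].
Definition oppz k : d.-tuple int := [tuple - tnth k i | i < d].

Lemma pairing_addz k l x : pairing (addz k l) x = pairing k x + pairing l x.
Proof.
rewrite /pairing -big_split /=; apply: eq_bigr => i _.
by rewrite tnth_mktuple rmorphD mulrDl.
Qed.

Lemma pairing_oppz k x : pairing (oppz k) x = - pairing k x.
Proof.
rewrite /pairing -sumrN; apply: eq_bigr => i _.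
by rewrite tnth_mktuple rmorphN mulNr.
Qed.

Lemma expi_addz k l x : expi (addz k l) x = expi k x * expi l x.
Proof.
rewrite /expi pairing_addz mulrDr cosD sinD.
by apply: complex_eqP; rewrite ?Re_mulc ?Im_mulc //= addrC.
Qed.

Lemma expi_oppz k x : expi (oppz k) x = ((expi k x)^*)%C.
Proof. by rewrite /expi pairing_oppz mulrN cosN sinN. Qed.

Lemma normc_expi k x : normc (expi k x) = 1.
Proof. by rewrite /normc /expi cos2Dsin2 sqrtr1. Qed.

Lemma measurable_expi k : measurable_torus (expi k : pt -> complex R).
Proof.
split.
  have := @measurable_cos_pairing R d k 0.
  by under eq_fun do rewrite addr0.
have := @measurable_cos_pairing R d k (- (pi / 2)).
by under eq_fun do rewrite cosBpihalf.
Qed.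

Lemma integrable_expi k : integrable_torus (expi k : pt -> complex R).
Proof.
apply: (@integrable_torus_bounded _ _ _ 1); first exact: measurable_expi.
by move=> x; rewrite normc_expi.
Qed.

Lemma integral_expi k : integral_torus (expi k : pt -> complex R)
  = if [forall i, tnth k i == 0] then 1 else 0.
Proof.
apply: complex_eqP => /=.
  have := @integral_cos_pairing R d k 0; rewrite cos0 => h.
  transitivity (if [forall i, tnth k i == 0] then 1 else 0 : R); last by case: ifP.
  by rewrite -h; apply: eq_Rintegral => x _; rewrite addr0.
have := @integral_cos_pairing R d k (- (pi / 2)).
rewrite -[X in cos X]add0r cosBpihalf sin0 if_same => h.
transitivity (0 : R); last by case: ifP.
by rewrite -h; apply: eq_Rintegral => x _; rewrite cosBpihalf.
Qed.

Lemma fourier_coef_sum (s : seq (d.-tuple int)) (c : d.-tuple int -> complex R) k :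
  uniq s ->
  fourier_coef (fun x => \sum_(l <- s) c l * expi l x) k
    = if k \in s then c k else 0.
Proof.
move=> us; rewrite /fourier_coef.
rewrite (@eq_integral_torus _ _ _ (fun x =>
    \sum_(l <- s) c l * expi (addz l (oppz k)) x)); last first.
  by move=> x; rewrite mulr_suml; apply: eq_bigr => l _;
     rewrite expi_addz expi_oppz mulrA.
rewrite integral_torus_sum; last first.
  by move=> l; apply: integrable_torusZ; exact: integrable_expi.
rewrite (eq_bigr (fun l => if l == k then c l else 0)); last first.
  move=> l _; rewrite integral_torusZ; last exact: integrable_expi.
  rewrite integral_expi (_ : [forall i, _] = (l == k)).
    by case: eqP => _; rewrite ?mulr1 ?mulr0.
  apply/forallP/eqP => [H|-> i]; last by rewrite !tnth_mktuple subrr.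
  apply: eq_from_tnth => i; have := H i; rewrite !tnth_mktuple subr_eq0.
  by move/eqP.
case: ifPn => ks.
  rewrite (bigD1_seq k) //= eqxx big1 ?addr0 // => l.
  by move=> /negbTE ->.
by rewrite big1_seq // => l /andP[_ ls]; case: eqP => // lk; rewrite -lk ls in ks.
Qed.

Lemma fourier_coefB (f g : pt -> complex R) k :
  integrable_torus f -> integrable_torus g ->
  fourier_coef (fun x => f x - g x) k = fourier_coef f k - fourier_coef g k.
Proof.
move=> fi gi; rewrite /fourier_coef.
have mul h : integrable_torus h -> integrable_torus (fun x => h x * ((expi k x)^*)%C).
  move=> hi; have -> : (fun x => h x * ((expi k x)^*)%C) = (fun x => h x * expi (oppz k) x).
    by apply/funext => x; rewrite expi_oppz.
  apply: (@integrable_torusM _ _ _ _ 1) => //; first exact: measurable_expi.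
  by move=> x; rewrite normc_expi.
rewrite (@eq_integral_torus _ _ _ (fun x => f x * ((expi k x)^*)%C
   + (-1) * (g x * ((expi k x)^*)%C))); last by move=> x; ring.
rewrite integral_torusD; [|exact: mul|by apply: integrable_torusZ; exact: mul].
by rewrite integral_torusZ ?mulN1r //; exact: mul.
Qed.

(** A list may repeat frequencies, so sums and products are formed without collecting equal
    terms. *)
Definition is_trig (phi : pt -> complex R) :=
  exists l : seq (complex R * d.-tuple int),
    forall x, phi x = \sum_(q <- l) q.1 * expi q.2 x.

Lemma is_trig_cst c : is_trig (fun=> c).
Proof.
exists [:: (c, [tuple 0 | i < d])] => x; rewrite big_cons big_nil addr0 /expi.
rewrite (_ : pairing _ x = 0) ?mulr0 ?cos0 ?sin0 //=; first last.
  by rewrite /pairing big1 // => i _; rewrite tnth_mktuple mul0r.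
by apply: complex_eqP; rewrite ?Re_mulc ?Im_mulc /=; ring.
Qed.

Lemma is_trig_expi k : is_trig (expi k).
Proof. by exists [:: (1, k)] => x; rewrite big_cons big_nil addr0 mul1r. Qed.

Lemma is_trigD f g : is_trig f -> is_trig g -> is_trig (fun x => f x + g x).
Proof. by move=> [l fl] [l' gl]; exists (l ++ l') => x; rewrite big_cat fl gl. Qed.

Lemma is_trigM f g : is_trig f -> is_trig g -> is_trig (fun x => f x * g x).
Proof.
move=> [l fl] [l' gl].
exists [seq (q.1 * q'.1, addz q.2 q'.2) | q <- l, q' <- l'] => x.
rewrite fl gl big_allpairs_dep mulr_suml; apply: eq_bigr => q _.
rewrite mulr_sumr; apply: eq_bigr => q' _ /=; rewrite expi_addz; ring.
Qed.

Lemma is_trig_sum (I : Type) (s : seq I) (F : I -> pt -> complex R) :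
  (forall i, is_trig (F i)) -> is_trig (fun x => \sum_(i <- s) F i x).
Proof.
move=> tF; elim: s => [|i s IH].
  under eq_fun do rewrite big_nil; exact: is_trig_cst.
under eq_fun do rewrite big_cons; exact: is_trigD.
Qed.

Lemma is_trigX f n : is_trig f -> is_trig (fun x => f x ^+ n).
Proof.
move=> tf; elim: n => [|n IH].
  under eq_fun do rewrite expr0; exact: is_trig_cst.
under eq_fun do rewrite exprS; exact: is_trigM.
Qed.

(** Integrating [u] against the character of frequency [q] gives the Fourier coefficient of [u] at
    [oppz q], whence the bound [M] on the negated frequencies. *)
Lemma is_trig_annihilated phi : is_trig phi ->
  exists M : nat, forall u : pt -> complex R, integrable_torus u ->
    (forall k, (normInf k <= M)%N -> fourier_coef u k = 0) ->
    integral_torus (fun x => u x * phi x) = 0.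
Proof.
move=> [l phil]; exists (\max_(q <- l) normInf (oppz q.2))%N => u ui uk.
rewrite (@eq_integral_torus _ _ _ (fun x =>
   \sum_(q <- l) q.1 * (u x * ((expi (oppz q.2) x)^*)%C))); last first.
  move=> x; rewrite phil mulr_sumr; apply: eq_bigr => q _.
  by rewrite expi_oppz conjcK; ring.
have iq q : integrable_torus (fun x => u x * ((expi (oppz q) x)^*)%C).
  have -> : (fun x => u x * ((expi (oppz q) x)^*)%C) = (fun x => u x * expi q x).
    by apply/funext => x; rewrite expi_oppz conjcK.
  apply: (@integrable_torusM _ _ _ _ 1) => //; first exact: measurable_expi.
  by move=> x; rewrite normc_expi.
rewrite integral_torus_sum; last by move=> q; exact: integrable_torusZ.
rewrite big1_seq // => q /andP[_ ql]; rewrite integral_torusZ //.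
rewrite -[integral_torus _]/(fourier_coef u (oppz q.2)) uk ?mulr0 //.
exact: leq_bigmax_seq.
Qed.

End Characters.

(** * Fourier inversion *)

Section Bumps.
Context (R : realType).
Local Notation unif := (uniform_prob (@ltr01 R)).

(** Translating [z] by an integer into [-1/2, 1/2] leaves the cosine unchanged, and there it
    decreases with the absolute value. Capping [delta] at 1/4 keeps the comparison inside
    [0, pi]. *)
Lemma cos_near_int (delta : R) : 0 < delta ->
  exists2 kap, 0 < kap &
    forall z : R, 1 - cos (2 * pi * z) < kap -> exists k : int, `|z + k%:~R| < delta.
Proof.
move=> d0; have pi0 := pi_gt0 R.
pose d1 := Num.min delta 4^-1.
have d10 : 0 < d1 by rewrite lt_min d0 /=; lra.
have d14 : d1 <= 4^-1 by rewrite ge_min lexx orbT.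
have in1 (y : R) : 0 <= y <= 2^-1 -> 2 * pi * y \in `[0, pi].
  move=> /andP[y0 y2]; rewrite in_itv /=; apply/andP; split.
    by rewrite !mulr_ge0 // ltW.
  have := ler_wpM2l (ltW pi0) y2; lra.
exists (1 - cos (2 * pi * d1)).
  rewrite subr_gt0 -[ltRHS]cos0 ltr_cos ?in_itv /= ?lexx ?(ltW pi0) //.
    by rewrite !mulr_gt0.
  by have := in1 d1; rewrite in_itv; apply; rewrite (ltW d10); lra.
move=> z hz.
pose k := - Num.floor (z + 2^-1); exists k.
have /andP[k1 k2] : (Num.floor (z + 2^-1))%:~R <= z + 2^-1 < (Num.floor (z + 2^-1) + 1)%:~R.
  exact: floor_itv.
rewrite intrD in k2.
have zk : `|z + k%:~R| <= 2^-1.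
  rewrite /k mulrNz ler_norml; lra.
have : cos (2 * pi * d1) < cos (2 * pi * `|z + k%:~R|).
  have -> : cos (2 * pi * `|z + k%:~R|) = cos (2 * pi * z).
    rewrite -(cosD2piz (2 * pi * z) k) -mulrDr.
    case: (ger0P (z + k%:~R)) => _ //; by rewrite mulrN cosN.
  lra.
rewrite ltr_cos ?in1 ?zk ?normr_ge0 //; last by lra.
rewrite ltr_pM2l ?mulr_gt0 // => /lt_le_trans; apply.
by rewrite ge_min lexx.
Qed.

Lemma exists_cos_bump (s kap : R) : 0 < kap ->
  exists g : R -> R,
  [/\ measurable_fun setT g, (forall y, 0 <= g y <= 1), 0 < \int[unif]_y g y &
      forall y, g y != 0 -> 1 - cos (2 * pi * (y - s)) < kap].
Proof.
move=> kap0; have pi0 := pi_gt0 R.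
have /cvgrPdist_lt /(_ _ kap0) /nbhs_ballP [e /= e0 He] := @continuous_cos R 0.
pose h := Num.min (e / (4 * pi)) 2^-1.
have h0 : 0 < h by rewrite lt_min divr_gt0 ?mulr_gt0 //=; lra.
have h2 : h <= 2^-1 by rewrite ge_min lexx orbT.
have he : 2 * pi * h < e.
  have : h <= e / (4 * pi) by rewrite ge_min lexx.
  rewrite ler_pdivlMr ?mulr_gt0 //; lra.
pose m := Num.floor s; pose s' := s - m%:~R.
have /andP[k1 k2] : m%:~R <= s < (m + 1)%:~R by exact: floor_itv.
rewrite intrD in k2.
(* An interval of length [h] with endpoint [s'], on the side where it stays inside [0, 1], the
   support of the uniform law. *)
pose a := if s' <= 2^-1 then s' else s' - h.
have a01 : 0 <= a /\ a + h <= 1.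
  rewrite /a; case: ifPn => hs; split; rewrite /s' in hs *; lra.
have as' y : a <= y <= a + h -> `|y - s'| <= h.
  move=> /andP[]; rewrite /a ler_norml; case: ifPn => _; lra.
exists (\1_(`[a, a + h]%classic)).
split.
- exact: measurable_indic.
- by move=> y; rewrite indicE; case: (_ \in _); rewrite ?lexx ?ler01.
- rewrite /Rintegral integral_uniform; last 2 first.
  + by apply/measurable_EFinP; exact: measurable_indic.
  + by move=> y; rewrite lee_fin indicE.
  rewrite subr0 invr1 mul1e integral_indic // setIidl; last first.
    move=> y /=; rewrite !in_itv /=; lra.
  by rewrite /= lebesgue_measure_itv /= lte_fin ltrDl h0 -EFinB /= addrC addKr.
move=> y; rewrite indicE pnatr_eq0 eqb0 negbK inE /= in_itv /= => /as' hy.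
have -> : cos (2 * pi * (y - s)) = cos (2 * pi * (y - s')).
  rewrite -(cosD2piz (2 * pi * (y - s)) m) -mulrDr; congr (cos (_ * _)).
  rewrite /s'; ring.
have := He (2 * pi * (y - s')); rewrite /ball /= cos0 sub0r normrN.
rewrite normrM gtr0_norm ?mulr_gt0 // => H.
have : 2 * pi * `|y - s'| < e.
  by apply: le_lt_trans he; rewrite ler_pM2l ?mulr_gt0.
by move=> /H; apply: le_lt_trans; exact: ler_norm.
Qed.

End Bumps.

Section Inversion.
Context (R : realType) (d : nat).
Local Notation pt := (torus_pt R d).
Local Notation mu := (haar R d).
Implicit Types (f g h : pt -> complex R).

Definition unif_close (delta : R) (x y : pt) :=
  forall i, `|tnth y i - tnth x i| < delta.

Definition eps_continuous f := forall x eps, 0 < eps ->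
  exists2 delta, 0 < delta &
    forall y, unif_close delta x y -> normc (f y - f x) < eps.

Lemma continuous_torus_eps f : continuous_torus f -> eps_continuous f.
Proof.
move=> cf x eps eps0.
pose v : 'rV[R]_d := \row_i tnth x i.
have vx : [tuple v ord0 i | i < d] = x.
  by apply: eq_from_tnth => i; rewrite tnth_mktuple mxE.
have e0 : 0 < eps%:C%C :> complex R by rewrite ltcR.
have /cvgrPdist_lt /(_ _ e0) /nbhs_ballP [e /= e1 He] := cf v.
exists e => // y hy.
pose w : 'rV[R]_d := \row_i tnth y i.
have wy : [tuple w ord0 i | i < d] = y.
  by apply: eq_from_tnth => i; rewrite tnth_mktuple mxE.
have : ball v e w.
  split=> // i j; rewrite /ball /= !mxE distrC; exact: hy.
have nE (z : complex R) :
    Num.sqrt (complex.Re z ^+ 2 + complex.Im z ^+ 2) = normc z by case: z.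
by move=> /He; rewrite vx wy -opprB normrN normc_def nE ltcR.
Qed.

Lemma eps_continuousD f g : eps_continuous f -> eps_continuous g ->
  eps_continuous (fun x => f x + g x).
Proof.
move=> cf cg x eps e0; have e2 : 0 < eps / 2 by lra.
have [d1 d10 h1] := cf x _ e2; have [d2 d20 h2] := cg x _ e2.
exists (Num.min d1 d2); first by rewrite lt_min d10.
move=> y hy.
have -> : f y + g y - (f x + g x) = (f y - f x) + (g y - g x) by ring.
apply: le_lt_trans (le_normcD _ _) _.
have y1 : unif_close d1 x y by move=> i; apply: lt_le_trans (hy i) _; rewrite ge_min lexx.
have y2 : unif_close d2 x y by move=> i; apply: lt_le_trans (hy i) _; rewrite ge_min lexx orbT.
have := h1 y y1; have := h2 y y2; lra.
Qed.

Lemma eps_continuousZ f (c : complex R) : eps_continuous f ->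
  eps_continuous (fun x => c * f x).
Proof.
move=> cf x eps e0.
have n0 : 0 < normc c + 1 by apply: ltr_wpDl => //; exact: normc_ge0.
have [d1 d10 h1] := cf x (eps / (normc c + 1)) (divr_gt0 e0 n0).
exists d1 => // y /h1; rewrite -mulrBr normcM ltr_pdivlMr // => hlt.
apply: le_lt_trans hlt; rewrite mulrC ler_wpM2l ?normc_ge0 //; lra.
Qed.

Lemma eps_continuous_expi k : eps_continuous (expi k : pt -> complex R).
Proof.
move=> x eps e0; have pi0 := pi_gt0 R; have e2 : 0 < eps / 2 by lra.
pose a := 2 * pi * pairing k x.
have /cvgrPdist_lt /(_ _ e2) /nbhs_ballP [e1 /= e10 He1] := @continuous_cos R a.
have /cvgrPdist_lt /(_ _ e2) /nbhs_ballP [e1' /= e1'0 He1'] := @continuous_sin R a.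
pose S : R := \sum_(i < d) `|(tnth k i)%:~R|.
have S0 : 0 <= S by apply: sumr_ge0.
pose e := Num.min e1 e1'.
have e00 : 0 < e by rewrite lt_min e10.
have D0 : 0 < 2 * pi * (S + 1) by rewrite !mulr_gt0 //; lra.
exists (e / (2 * pi * (S + 1))); first by rewrite divr_gt0.
move=> y hy.
have close : `|a - 2 * pi * pairing k y| < e.
  rewrite -mulrBr normrM gtr0_norm ?mulr_gt0 // /pairing -sumrB.
  apply: (@le_lt_trans _ _ (2 * pi * (S * (e / (2 * pi * (S + 1)))))).
    rewrite ler_pM2l ?mulr_gt0 // mulr_suml.
    apply: le_trans (ler_norm_sum _ _ _) _; apply: ler_sum => i _.
    rewrite -mulrBr normrM ler_wpM2l // distrC; exact: ltW.
  have -> : 2 * pi * (S * (e / (2 * pi * (S + 1)))) = e * (S / (S + 1)).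
    by field; rewrite !gt_eqF //; lra.
  rewrite -[ltRHS]mulr1 ltr_pM2l // ltr_pdivrMr; lra.
apply: le_lt_trans (normc_le_Re_Im (expi k y - expi k x)) _ => /=.
have c1 : ball a e1 (2 * pi * pairing k y).
  by rewrite /ball /=; apply: lt_le_trans close _; rewrite ge_min lexx.
have c2 : ball a e1' (2 * pi * pairing k y).
  by rewrite /ball /=; apply: lt_le_trans close _; rewrite ge_min lexx orbT.
have := He1 _ c1; have := He1' _ c2; rewrite !(distrC _ (_ (2 * pi * pairing k y))).
rewrite -/a; lra.
Qed.

Lemma eps_continuous_sum (I : Type) (s : seq I) (F : I -> pt -> complex R) :
  (forall i, eps_continuous (F i)) -> eps_continuous (fun x => \sum_(i <- s) F i x).
Proof.
move=> cF; elim: s => [|i s IH].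
  under eq_fun do rewrite big_nil.
  by move=> x eps e0; exists 1 => // y _; rewrite subrr normc0.
under eq_fun do rewrite big_cons; exact: eps_continuousD.
Qed.

Lemma periodic_expi k : Zd_periodic (expi k : pt -> complex R).
Proof.
move=> x l; rewrite /expi.
have -> : 2 * pi * pairing k [tuple tnth x i + (tnth l i)%:~R | i < d]
   = 2 * pi * pairing k x + 2 * pi * (\sum_(i < d) tnth k i * tnth l i)%:~R.
  rewrite -mulrDr; congr (_ * _).
  rewrite rmorph_sum /= /pairing -big_split /=; apply: eq_bigr => i _.
  by rewrite tnth_mktuple mulrDr intrM.
by rewrite cosD2piz sinD2piz.
Qed.

End Inversion.

(** * Boxes of frequencies *)

Section Box.
Context (d : nat).
Implicit Types (k : d.-tuple int).

(** The index type is also that of the grid points, so the characters of the box and the points of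
    the grid are equal in number. *)
Definition box_freq M (kap : {ffun 'I_d -> 'I_(2 * M).+1}) : d.-tuple int :=
  [tuple (kap i : nat)%:Z - M%:Z | i < d].

Definition box M : seq (d.-tuple int) := codom (@box_freq M).

Lemma box_freq_inj M : injective (@box_freq M).
Proof.
move=> k l /(congr1 (fun t : d.-tuple int => tnth t)) kl; apply/ffunP => i.
have := congr1 (fun F => F i) kl; rewrite !tnth_mktuple => /addIr [].
exact: val_inj.
Qed.

Lemma box_uniq M : uniq (box M).
Proof. by rewrite map_inj_uniq ?enum_uniq //; exact: box_freq_inj. Qed.

Lemma normInf_leP k M :
  reflect (forall i, (`|tnth k i| <= M)%N) (normInf k <= M)%N.
Proof.
rewrite /normInf; apply: (iffP (bigop.bigmax_leqP _ _ _)) => [H i|H i _]; [exact: H|exact: H].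
Qed.

Lemma mem_box k M : (k \in box M) = (normInf k <= M)%N.
Proof.
apply/idP/idP => [/codomP[kap ->]|/normInf_leP H].
  apply/normInf_leP => i; rewrite tnth_mktuple.
  have := ltn_ord (kap i); move: (nat_of_ord _) => z; lia.
have lt i : (absz (tnth k i + M%:Z)%R < (2 * M).+1)%N by have := H i; lia.
apply/codomP; exists [ffun i => Ordinal (lt i)].
apply: eq_from_tnth => i; rewrite tnth_mktuple ffunE /=.
have := H i; lia.
Qed.

Lemma big_box (V : zmodType) M (F : d.-tuple int -> V) :
  \sum_(k <- box M) F k = \sum_kap F (@box_freq M kap).
Proof. by rewrite big_map big_enum. Qed.

Lemma big_box_sub (V : zmodType) M M' (F : d.-tuple int -> V) : (M <= M')%N ->
  \sum_(k <- box M') F k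
   = \sum_(k <- box M) F k + \sum_(k <- box M' | (M < normInf k)%N) F k.
Proof.
move=> MM'; rewrite (bigID (fun k => normInf k <= M)%N) /=; congr (_ + _).
  rewrite -big_filter; apply: perm_big; apply: uniq_perm.
  - by rewrite filter_uniq // box_uniq.
  - exact: box_uniq.
  - by move=> k; rewrite mem_filter !mem_box andb_idr // => /leq_trans; apply.
by apply: eq_bigl => k; rewrite ltnNge.
Qed.

End Box.

Section Inversion.
Context (R : realType) (d : nat).
Local Notation pt := (torus_pt R d).
Local Notation mu := (haar R d).
Implicit Types (f g h : pt -> complex R).

Definition psum f M (x : pt) : complex R :=
  \sum_(k <- box d M) fourier_coef f k * expi k x.

(** A substitute for the squared distance modulo Z^d that is itself a trigonometric polynomial in
    [y]. *)
Definition cos_dist (x y : pt) : R :=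
  \sum_(i < d) (1 - cos (2 * pi * (tnth y i - tnth x i))).

Lemma is_trig_cos_coord (s : R) i :
  is_trig (fun y : pt => (cos (2 * pi * (tnth y i - s)))%:C%C).
Proof.
pose k : d.-tuple int := [tuple (j == i)%:Z | j < d].
have pk (y : pt) : pairing k y = tnth y i.
  rewrite /pairing (bigD1 i) //= tnth_mktuple eqxx mul1r big1 ?addr0 // => j.
  by move=> /negbTE ji; rewrite tnth_mktuple ji mul0r.
pose z : complex R := (cos (2 * pi * s) / 2 -i* (sin (2 * pi * s) / 2))%C.
have -> : (fun y : pt => (cos (2 * pi * (tnth y i - s)))%:C%C)
    = (fun y => z * expi k y + (z^*)%C * expi (oppz k) y).
  apply/funext => y; rewrite expi_oppz /expi pk mulrBr cosB.
  apply: complex_eqP; rewrite raddfD /= ?Re_mulc ?Im_mulc /=; by field.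
apply: (@is_trigD _ _ (fun y => z * expi k y) (fun y => (z^*)%C * expi (oppz k) y)).
  by apply: (@is_trigM _ _ (fun=> z)); [exact: is_trig_cst|exact: is_trig_expi].
by apply: (@is_trigM _ _ (fun=> (z^*)%C)); [exact: is_trig_cst|exact: is_trig_expi].
Qed.

Lemma is_trig_cos_dist (x : pt) : is_trig (fun y => (cos_dist x y)%:C%C).
Proof.
have -> : (fun y => (cos_dist x y)%:C%C) = (fun y => \sum_(i < d)
    (1 + (-1) * (cos (2 * pi * (tnth y i - tnth x i)))%:C%C)).
  apply/funext => y; rewrite /cos_dist rmorph_sum /=; apply: eq_bigr => i _.
  by rewrite rmorphB mulN1r.
apply: is_trig_sum => i; apply: is_trigD; first exact: is_trig_cst.
by apply: is_trigM; [exact: is_trig_cst|exact: is_trig_cos_coord].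
Qed.

Lemma cos_dist_itv (x y : pt) : 0 <= cos_dist x y <= 2 * d%:R.
Proof.
apply/andP; split.
  by apply: sumr_ge0 => i _; rewrite subr_ge0 cos_le1.
apply: (@le_trans _ _ (\sum_(i < d) 2)).
  by apply: ler_sum => i _; have := cos_geN1 (2 * pi * (tnth y i - tnth x i)); lra.
by rewrite sumr_const card_ord mulr_natr.
Qed.

Lemma cos_dist_close (x : pt) (delta : R) : 0 < delta ->
  exists2 kap, 0 < kap & forall y, cos_dist x y < kap ->
    exists k : d.-tuple int,
      unif_close delta x [tuple tnth y i + (tnth k i)%:~R | i < d].
Proof.
move=> d0; have [kap kap0 H] := cos_near_int d0; exists kap => // y hy.
have /choice[k hk] : forall i, exists k : int,
    `|tnth y i - tnth x i + k%:~R| < delta.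
  move=> i; apply: H; apply: le_lt_trans hy.
  rewrite /cos_dist (bigD1 i) //= lerDl; apply: sumr_ge0 => j _.
  by rewrite subr_ge0 cos_le1.
exists [tuple k i | i < d] => i; rewrite !tnth_mktuple.
by rewrite addrAC.
Qed.

Lemma cos_dist_bump (x : pt) (kap : R) : (0 < d)%N -> 0 < kap ->
  exists G : pt -> R,
  [/\ measurable_fun setT G, (forall y, 0 <= G y <= 1), 0 < \int[mu]_y G y &
      forall y, G y != 0 -> cos_dist x y < kap].
Proof.
move=> d0 kap0; have dR : 0 < d%:R :> R by rewrite ltr0n.
have /choice[g hg] : forall i : 'I_d, exists g : R -> R,
  [/\ measurable_fun setT g, (forall y, 0 <= g y <= 1),
      0 < \int[uniform_prob (@ltr01 R)]_y g y &
      forall y, g y != 0 -> 1 - cos (2 * pi * (y - tnth x i)) < kap / d%:R].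
  by move=> i; apply: exists_cos_bump; rewrite divr_gt0.
have mg i : measurable_fun setT (g i) by case: (hg i).
have g01 i y : 0 <= g i y <= 1 by case: (hg i).
exists (fun y => \prod_i g i (tnth y i)); split.
- apply: measurable_prod => i _; apply: measurableT_comp => //.
  exact: measurable_tnth.
- move=> y; apply/andP; split; first by apply: prodr_ge0 => i _; case/andP: (g01 i (tnth y i)).
  by apply: prodr_ile1 => i _; exact: g01.
- rewrite power_prob_integral_prod //; apply: prodr_gt0 => i _.
  by case: (hg i).
move=> y /prodf_neq0 H.
apply: (@lt_le_trans _ _ (\sum_(i < d) (kap / d%:R))).
  apply: ltr_sum; first by apply/hasP; exists (Ordinal d0); rewrite ?mem_index_enum.
  by move=> i _; case: (hg i) => _ _ _; apply; exact: H.
by rewrite sumr_const card_ord -(mulr_natr (kap / d%:R)) divfK ?gt_eqF.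
Qed.

Lemma integrable_psum f M : integrable_torus (psum f M).
Proof.
by apply: integrable_torus_sum => k; apply: integrable_torusZ; exact: integrable_expi.
Qed.

Lemma fourier_coef_sub_psum f M k : integrable_torus f -> (normInf k <= M)%N ->
  fourier_coef (fun x => f x - psum f M x) k = 0.
Proof.
move=> fi kM; rewrite fourier_coefB //; last exact: integrable_psum.
by rewrite [X in _ - X]fourier_coef_sum ?box_uniq // mem_box kM subrr.
Qed.

(** Rotating by a phase replaces the modulus at one point by a real part, so that the peaking
    argument can compare real integrands. *)
Lemma exists_phase (z : complex R) :
  exists2 th : complex R, normc th <= 1 & complex.Re (th * z) = normc z.
Proof.
have [->|z0] := eqVneq z 0.
  by exists 0; rewrite ?mul0r ?normc0 //= raddf0.
have n0 : 0 < normc z.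
  rewrite lt_neqAle normc_ge0 andbT eq_sym; apply: contra z0 => /eqP.
  by move=> /eq0_normc ->.
exists ((normc z)^-1%:C%C * (z^*)%C).
  rewrite normcM normc_real ger0_norm ?invr_ge0 ?normc_ge0 //.
  have -> : normc (z^*)%C = normc z by case: z {z0 n0} => a b /=; rewrite sqrrN.
  by rewrite mulVf ?gt_eqF.
rewrite -mulrA Re_realM Re_mulc.
have -> : complex.Re (z^*)%C * complex.Re z - complex.Im (z^*)%C * complex.Im z
  = normc z ^+ 2.
  by rewrite sqr_normcE; case: z {z0 n0} => a b /=; ring.
by rewrite expr2 mulKf // gt_eqF.
Qed.

(* The kernels [t ^+ n] are nonnegative trigonometric polynomials, at most 1 away
   from [x] modulo [Z^d] and at least [(1 + a) ^+ n] close to it: integrating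
   [f - psum f M'] against them gives 0 for large [M'], although it would grow
   if [f x - psum f M x] exceeded [eta]. *)
Lemma fourier_inversion f M (eta : R) : (0 < d)%N ->
  Zd_periodic f -> continuous_torus f -> integrable_torus f ->
  (forall M' x, (M <= M')%N -> normc (psum f M' x - psum f M x) <= eta) ->
  forall x, normc (f x - psum f M x) <= eta.
Proof.
move=> d0 pf cf fi Heta x; rewrite leNgt; apply/negP => lt.
have dR : 0 < d%:R :> R by rewrite ltr0n.
have eta0 : 0 <= eta by apply: le_trans (Heta M x (leqnn _)); exact: normc_ge0.
have [th th1 hth] := exists_phase (f x - psum f M x).
pose w y := complex.Re (th * (f y - psum f M y)).
pose eps := (normc (f x - psum f M x) - eta) / 2.
have eps0 : 0 < eps by rewrite /eps; lra.
have cw : eps_continuous (fun y => f y - psum f M y).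
  have -> : (fun y => f y - psum f M y) = (fun y => f y + (-1) * psum f M y).
    by apply/funext => y; rewrite mulN1r.
  apply: eps_continuousD; first exact: continuous_torus_eps.
  apply: eps_continuousZ; apply: eps_continuous_sum => k; apply: eps_continuousZ.
  exact: eps_continuous_expi.
have pw y (k : d.-tuple int) : w [tuple tnth y i + (tnth k i)%:~R | i < d] = w y.
  rewrite /w pf /psum; congr (complex.Re (th * (_ - _))).
  by apply: eq_bigr => l _; rewrite periodic_expi.
have [delta delta0 hdelta] := cw x _ eps0.
have [kap0 kap00 hkap0] := cos_dist_close x delta0.
have near y : cos_dist x y < kap0 -> eta + eps < w y.
  move=> /hkap0 [k /hdelta]; rewrite -(pw y k); set y' := [tuple _ | _ < d] => h.
  have : `|w y' - w x| < eps.
    apply: le_lt_trans h; rewrite /w -raddfB -mulrBr /=.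
    apply: le_trans (normr_Re_le _) _; rewrite normcM.
    by rewrite ler_piMl // normc_ge0.
  rewrite ltr_norml => /andP[h1 _].
  have -> : eta + eps = w x - eps by rewrite /w hth /eps; lra.
  lra.
pose kap := Num.min kap0 1.
have kappa0 : 0 < kap by rewrite lt_min kap00 ltr01.
have kap1 : kap <= 1 by rewrite ge_min lexx orbT.
have {}near y : cos_dist x y < kap -> eta + eps < w y.
  by move=> h; apply: near; apply: lt_le_trans h _; rewrite ge_min lexx.
have kap4 : 0 < kap / 4 by lra.
have [G [mG G01 IG HG]] := cos_dist_bump x d0 kap4.
(* [cos_dist] is at most 2d, so dividing by 2d keeps [t] nonnegative. The pivot [kap / 2] puts [t]
   at most 1 where [cos_dist] is at least [kap], and at least [1 + a] where it is below
   [kap / 4]. *)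
pose t y := 1 + (kap / 2 - cos_dist x y) / (2 * d%:R).
have t0 y : 0 <= t y.
  have /andP[_ h] := cos_dist_itv x y.
  rewrite /t addrC -lerBlDr sub0r ler_pdivlMr ?mulr_gt0 //; lra.
have t_out y : kap <= cos_dist x y -> t y <= 1.
  move=> h; rewrite /t gerDl ler_pdivrMr ?mulr_gt0 // mul0r; lra.
pose a := kap / (8 * d%:R).
have a0 : 0 < a by rewrite /a divr_gt0 // mulr_gt0.
have t_in y : cos_dist x y < kap / 4 -> 1 + a <= t y.
  move=> h; rewrite /t lerD2l ler_pdivlMr ?mulr_gt0 //.
  have -> : a * (2 * d%:R) = kap / 4 by rewrite /a; field; rewrite gt_eqF.
  lra.
have tT : is_trig (fun y => (t y)%:C%C).
  have -> : (fun y => (t y)%:C%C) = (fun y => (1 + kap / (4 * d%:R))%:C%C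
      + (- (2 * d%:R)^-1)%:C%C * (cos_dist x y)%:C%C).
    apply/funext => y; apply: complex_eqP; rewrite /t /=; last by ring.
    by field; rewrite gt_eqF.
  apply: is_trigD; first exact: is_trig_cst.
  by apply: is_trigM; [exact: is_trig_cst|exact: is_trig_cos_dist].
have mw : integrable_torus (fun y => th * (f y - psum f M y)).
  apply: integrable_torusZ.
  have -> : (fun y => f y - psum f M y) = (fun y => f y + (-1) * psum f M y).
    by apply/funext => y; rewrite mulN1r.
  by apply: integrable_torusD => //; apply: integrable_torusZ; exact: integrable_psum.
have iw : mu.-integrable setT (EFin \o w) by case: mw.
pose I := \int[mu]_y `|w y|.
have I0 : 0 <= I by apply: Rintegral_ge0.
pose D := \int[mu]_y G y.
have bound n : eps * (1 + a) ^+ n * D <= I + eta.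
  have [M1 HM1] := is_trig_annihilated (is_trigX n tT).
  (* The truncation must exceed the degree of the kernel and so depends on [n]; [Heta] is uniform in
     [M'], which keeps the error made in replacing [w] at most [eta] for all [n]. *)
  pose M' := maxn M M1.
  pose u y := th * (f y - psum f M' y).
  have ui : integrable_torus (fun y => f y - psum f M' y).
    have -> : (fun y => f y - psum f M' y) = (fun y => f y + (-1) * psum f M' y).
      by apply/funext => y; rewrite mulN1r.
    by apply: integrable_torusD => //; apply: integrable_torusZ; exact: integrable_psum.
  pose W y := complex.Re (u y) * t y ^+ n.
  have tn_le y : `|t y ^+ n| <= 2 ^+ n.
    rewrite ger0_norm ?exprn_ge0 // lerXn2r ?nnegrE //.
    have /andP[h _] := cos_dist_itv x y.
    have d1 : 1 <= d%:R :> R by rewrite ler1n.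
    have : (kap / 2 - cos_dist x y) / (2 * d%:R) <= 1.
      rewrite ler_pdivrMr ?mulr_gt0 //; lra.
    rewrite /t; lra.
  have mtn : measurable_torus (fun y => ((t y)%:C%C) ^+ n).
    have [l hl] := is_trigX n tT.
    under eq_fun do rewrite hl.
    apply: measurable_torus_sum => q; apply: measurable_torusM.
      exact: measurable_torus_cst.
    exact: measurable_expi.
  have iWc : integrable_torus (fun y => (f y - psum f M' y) * (t y)%:C%C ^+ n).
    apply: (@integrable_torusM _ _ _ _ (2 ^+ n)) => // y.
    by rewrite -rmorphXn normc_real.
  have WE y : W y = complex.Re (th * ((f y - psum f M' y) * (t y)%:C%C ^+ n)).
    rewrite /W -rmorphXn mulrA -/(u y).
    by rewrite [u y * _]mulrC Re_realM mulrC.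
  have W0 : \int[mu]_y W y = 0.
    have : integral_torus (fun y => th * ((f y - psum f M' y) * (t y)%:C%C ^+ n)) = 0.
      rewrite integral_torusZ // HM1 ?mulr0 // => k kM.
      by apply: fourier_coef_sub_psum => //; apply: leq_trans kM _; rewrite leq_maxr.
    move=> /(congr1 (@complex.Re R)) /= <-; apply: eq_Rintegral => y _.
    exact: WE.
  have iW : mu.-integrable setT (EFin \o W).
    have [h _] := integrable_torusZ th iWc.
    by apply: eq_integrable h => // y _ /=; rewrite WE.
  have uw y : `|complex.Re (u y) - w y| <= eta.
    rewrite /u /w -raddfB -mulrBr; apply: le_trans (normr_Re_le _) _.
    rewrite normcM; apply: le_trans (_ : normc (psum f M' y - psum f M y) <= _).
      have -> : f y - psum f M' y - (f y - psum f M y)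
         = - (psum f M' y - psum f M y) by ring.
      by rewrite normcN ler_piMl // normc_ge0.
    by apply: Heta; rewrite leq_maxl.
  (* Near [x] the integrand is positive, and at least [eps * (1 + a) ^+ n] on the support of [G].
     Farther away the kernel is at most 1 and the integrand is at least [- (|w y| + eta)]. The
     second term does not grow with [n]. *)
  have low y : eps * (1 + a) ^+ n * G y - (`|w y| + eta) <= W y.
    have := uw y; rewrite ler_norml => /andP[u1 u2].
    have /andP[G0 G1] := G01 y.
    have [hn|hf] := ltP (cos_dist x y) kap.
      have hw := near y hn.
      have e1 : eps <= complex.Re (u y) by lra.
      apply: (@le_trans _ _ (eps * t y ^+ n)); last first.
        by rewrite /W ler_wpM2r // exprn_ge0.
      apply: (@le_trans _ _ (eps * ((1 + a) ^+ n * G y))).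
        by rewrite mulrA gerBl addr_ge0.
      rewrite ler_pM2l //; have [->|/HG hin] := eqVneq (G y) 0.
        by rewrite mulr0 exprn_ge0.
      apply: (@le_trans _ _ ((1 + a) ^+ n)).
        by rewrite ler_piMr // exprn_ge0 //; lra.
      by rewrite lerXn2r ?nnegrE // ?t_in //; lra.
    have -> : G y = 0.
      by apply/eqP; apply: contraTT hf => /HG h; rewrite -ltNge; lra.
    rewrite mulr0 sub0r.
    have : `|W y| <= `|w y| + eta.
      rewrite /W normrM; apply: (@le_trans _ _ `|complex.Re (u y)|).
        rewrite ler_piMr // ger0_norm ?exprn_ge0 // exprn_ile1 //.
        exact: t_out.
      have := ler_normD (complex.Re (u y) - w y) (w y); rewrite subrK => h.
      have := uw y; lra.
    by rewrite ler_norml => /andP[].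
  have iG : mu.-integrable setT (EFin \o (fun y => eps * (1 + a) ^+ n * G y)).
    apply: (@bounded_integrable_prob _ _ _ _ _ (eps * (1 + a) ^+ n)).
      exact: measurable_funM.
    have e00 : 0 <= eps * (1 + a) ^+ n.
      by rewrite mulr_ge0 ?exprn_ge0 // ?ltW //; lra.
    move=> y; have /andP[G0 G1] := G01 y.
    by rewrite ger0_norm; [exact: ler_piMr|exact: mulr_ge0].
  have ieta : mu.-integrable setT (EFin \o (fun=> eta)).
    by apply: (@bounded_integrable_prob _ _ _ _ _ `|eta|).
  have iwe : mu.-integrable setT (EFin \o (fun y => `|w y| + eta)).
    by apply: eq_integrable (integrableD _ (integrable_norm iw) ieta) => // y _.
  have := le_Rintegral measurableT _ iW (fun y _ => low y).
  rewrite W0 RintegralB // RintegralD //; last exact: integrable_norm.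
  rewrite RintegralZl ?Rintegral_cst_prob //; last first.
    apply: (@bounded_integrable_prob _ _ _ _ _ 1) => // y.
    by have /andP[G0 G1] := G01 y; rewrite ger0_norm.
  rewrite -/D -/I subr_le0; apply.
  by apply: eq_integrable (integrableB _ iG iwe) => // y _.
have D0 : 0 < D by [].
have aD : 0 < eps * a * D := mulr_gt0 (mulr_gt0 eps0 a0) D0.
have [n hn] : exists n : nat, (I + eta) / (eps * a * D) < n%:R.
  exists (Num.truncn ((I + eta) / (eps * a * D))).+1.
  exact: truncnS_gt.
have := bound n; rewrite leNgt => /negP; apply.
rewrite ltr_pdivrMr // in hn; apply: lt_le_trans hn _.
have -> : n%:R * (eps * a * D) = eps * (n%:R * a) * D by ring.
rewrite ler_pM2r // ler_pM2l //.
apply: (@le_trans _ _ (1 + n%:R * a)); first by lra.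
(* Bernoulli's inequality. *)
elim: n => [|n IH]; first by rewrite mul0r addr0 expr0.
rewrite exprS -natr1; have : 0 <= n%:R * a * a by rewrite !mulr_ge0 // ltW.
have a1 : 0 <= 1 + a by lra.
have := ler_wpM2l a1 IH; lra.
Qed.

End Inversion.

(** * The Wiener ball *)

Lemma powR_le1 (R : realType) (x p : R) : 0 < p -> 0 <= x -> x `^ p <= 1 -> x <= 1.
Proof.
move=> p0 x0; rewrite !leNgt; apply: contra => x1.
have : 1 `^ p < x `^ p by apply: gt0_ltr_powR; rewrite ?nnegrE.
by rewrite powR1.
Qed.

Lemma le_powR_le1 (R : realType) (x p : R) : 0 < p <= 1 -> 0 <= x <= 1 -> x <= x `^ p.
Proof.
move=> /andP[p0 p1]; rewrite le_eqVlt => /andP[/orP[/eqP <- _|x0 x1]].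
  exact: powR_ge0.
by apply: ger1_powR => //; rewrite x0.
Qed.

Section L2.
Context (R : realType) (d : nat).
Local Notation pt := (torus_pt R d).
Local Notation mu := (haar R d).

(** Only the conjugate factor is expanded: each term is then a Fourier coefficient of the whole sum,
    known from [fourier_coef_sum]. *)
Lemma parseval_trig (s : seq (d.-tuple int)) (c : d.-tuple int -> complex R) :
  uniq s ->
  \int[mu]_x normc (\sum_(k <- s) c k * expi k x) ^+ 2
    = \sum_(k <- s) normc (c k) ^+ 2.
Proof.
move=> us; pose S (x : pt) := \sum_(k <- s) c k * expi k x.
have iS : integrable_torus S.
  by apply: integrable_torus_sum => k; apply: integrable_torusZ; exact: integrable_expi.
have iSe k : integrable_torus (fun x => S x * ((expi k x)^*)%C).
  have -> : (fun x => S x * ((expi k x)^*)%C) = (fun x => S x * expi (oppz k) x).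
    by apply/funext => x; rewrite expi_oppz.
  apply: (@integrable_torusM _ _ _ _ 1) => //; first exact: measurable_expi.
  by move=> x; rewrite normc_expi.
have ReJ (z w : complex R) : z = w -> complex.Re ((z^*)%C * w) = normc z ^+ 2.
  by move=> <-; rewrite sqr_normcE; case: z => a b /=; ring.
transitivity (complex.Re (integral_torus (fun x =>
    \sum_(k <- s) ((c k)^*)%C * (S x * ((expi k x)^*)%C)))).
  apply: eq_Rintegral => x _ /=; rewrite -(ReJ _ _ erefl); congr complex.Re.
  rewrite -/(S x) [in X in (X^*)%C * _]/S rmorph_sum mulr_suml.
  by apply: eq_bigr => k _; rewrite rmorphM /=; ring.
rewrite integral_torus_sum; last by move=> k; exact: integrable_torusZ.
rewrite Re_sum; rewrite !big_seq; apply: eq_bigr => k ks.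
rewrite integral_torusZ // -[integral_torus _]/(fourier_coef S k).
by rewrite fourier_coef_sum // ks; exact: ReJ.
Qed.

Lemma measurable_normc (f : pt -> complex R) : measurable_torus f ->
  measurable_fun setT (fun x => normc (f x) : measurableTypeR R).
Proof.
move=> [fR fI].
rewrite (_ : (fun x => _) =
   (fun x => Num.sqrt (complex.Re (f x) ^+ 2 + complex.Im (f x) ^+ 2))); last first.
  by apply/funext => x; case: (f x).
apply: measurableT_comp; first by apply: continuous_measurable_fun; exact: sqrt_continuous.
by apply: measurable_funD; exact: measurable_funX.
Qed.

(** The pointwise bound of |g|^2 by 2|S|^2 + 2 eta^2, where S is the trigonometric sum, is
    integrated against a probability measure. *)
Lemma L2norm_le (g : pt -> complex R) (s : seq (d.-tuple int))
    (c : d.-tuple int -> complex R) (eta : R) :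
  measurable_torus g -> uniq s -> 0 <= eta ->
  (forall x, normc (g x - \sum_(k <- s) c k * expi k x) <= eta) ->
  (L2norm g
    <= (Num.sqrt (2 * \sum_(k <- s) normc (c k) ^+ 2 + 2 * eta ^+ 2))%:E)%E.
Proof.
move=> mg us eta0 hg; set S := fun x => \sum_(k <- s) c k * expi k x.
rewrite /L2norm unlock /=.
have mS : measurable_torus S.
  apply: measurable_torus_sum => k; apply: measurable_torusM.
    exact: measurable_torus_cst.
  exact: measurable_expi.
pose U x := 2 * normc (S x) ^+ 2 + 2 * eta ^+ 2.
have sq x : normc (g x) ^+ 2 <= U x.
  have h := le_normcD (g x - S x) (S x); rewrite subrK in h.
  have := hg x; rewrite -/(S x) => h2.
  apply: (@le_trans _ _ ((eta + normc (S x)) ^+ 2)).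
    rewrite ler_sqr ?nnegrE ?addr_ge0 ?normc_ge0 //; lra.
  rewrite /U; have := sqr_ge0 (eta - normc (S x)); rewrite sqrrB sqrrD; lra.
have mU : measurable_fun setT U.
  by apply: measurable_funD => //; apply: measurable_funM => //;
     apply: measurable_funX; exact: measurable_normc.
have bS x : normc (S x) <= \sum_(k <- s) normc (c k).
  apply: le_trans (le_normc_sum _ _ _) _; apply: ler_sum => k _.
  by rewrite normcM normc_expi mulr1.
have iS2 : mu.-integrable setT (EFin \o (fun x => normc (S x) ^+ 2)).
  apply: (@bounded_integrable_prob _ _ _ _ _ ((\sum_(k <- s) normc (c k)) ^+ 2)).
    by apply: measurable_funX; exact: measurable_normc.
  move=> x; rewrite ger0_norm ?sqr_ge0 // ler_sqr ?nnegrE ?normc_ge0 //.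
  by apply: sumr_ge0 => k _; exact: normc_ge0.
have iU : (\int[mu]_x (U x)%:E
   = (2 * \sum_(k <- s) normc (c k) ^+ 2 + 2 * eta ^+ 2)%:E)%E.
  have iZ : mu.-integrable setT (EFin \o (fun x => 2 * normc (S x) ^+ 2)).
    by apply: eq_integrable (integrableZl _ 2 iS2).
  have ieta : mu.-integrable setT (EFin \o (fun=> 2 * eta ^+ 2)).
    by apply: (@bounded_integrable_prob _ _ _ _ _ `|2 * eta ^+ 2|).
  have -> : 2 * \sum_(k <- s) normc (c k) ^+ 2 + 2 * eta ^+ 2 = \int[mu]_x U x.
    rewrite -(parseval_trig c us) -(RintegralZl 2 measurableT iS2).
    by rewrite -[X in _ + X](Rintegral_cst_prob mu) -RintegralD.
  rewrite fineK //; apply: integrable_fin_num => //.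
  by apply: eq_integrable (integrableD _ iZ ieta).
have V0 : 0 <= 2 * \sum_(k <- s) normc (c k) ^+ 2 + 2 * eta ^+ 2.
  by rewrite addr_ge0 ?mulr_ge0 ?sqr_ge0 ?sumr_ge0 // => k _; exact: sqr_ge0.
rewrite -powR12_sqrt // -poweR_EFin -iU.
have le : (\int[mu]_x (`|normc (g x)| `^ 2)%:E <= \int[mu]_x (U x)%:E)%E.
  apply: ge0_le_integral => //.
  - apply/measurable_EFinP.
    rewrite (_ : (fun x => _) = (fun x => normc (g x) ^+ 2)); last first.
      by apply/funext => x; rewrite powR_mulrn // real_normK ?num_real.
    by apply: measurable_funX; exact: measurable_normc.
  - by apply/measurable_EFinP.
  - by move=> x _; rewrite lee_fin powR_mulrn // real_normK ?num_real.
apply: gt0_ler_poweR => //; rewrite in_itv /= leey andbT.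
  by apply: integral_ge0 => x _; rewrite lee_fin powR_ge0.
by rewrite iU lee_fin.
Qed.

End L2.

Section WienerBall.
Context (R : realType) (d : nat) (r p : R).
Hypotheses (d0 : (0 < d)%N) (r0 : 0 < r) (p0 : 0 < p) (p1 : p <= 1).
Local Notation pt := (torus_pt R d).
Implicit Types (f : pt -> complex R).

Definition wcoef f k : R := normc (fourier_coef f k) * (1 + (normInf k)%:R) `^ r.

Lemma wcoef_ge0 f k : 0 <= wcoef f k.
Proof. by rewrite mulr_ge0 ?normc_ge0 ?powR_ge0. Qed.

Lemma wiener_ball_sum_powR f (s : seq (d.-tuple int)) : wiener_ball r p f -> uniq s ->
  \sum_(k <- s) wcoef f k `^ p <= 1.
Proof.
move=> [_]; rewrite /wiener_norm => hn us.
set E := (X in (X `^ _)%E) in hn.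
have sE : ((\sum_(k <- s) wcoef f k `^ p)%:E <= E)%E.
  apply: esum_ge; exists [set` s]; first by split => //; exact: finite_seq.
  by rewrite -fsbig_seq // sumEFin.
have s0 : 0 <= \sum_(k <- s) wcoef f k `^ p.
  by apply: sumr_ge0 => k _; exact: powR_ge0.
have pV : 0 < p^-1 by rewrite invr_gt0.
move: hn sE; case: E => [e| |//].
- rewrite poweR_EFin !lee_fin => e1 se; apply: le_trans se _.
  have [e0|e0] := leP 0 e; last by lra.
  exact: powR_le1 e1.
- by rewrite /poweR gt_eqF // leye_eq.
Qed.

(** The unit ball of l^p lies in that of l^1 for p at most 1: every weighted coefficient is at most
    1, hence at most its p-th power. *)
Lemma wiener_ball_sum f (s : seq (d.-tuple int)) : wiener_ball r p f -> uniq s ->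
  \sum_(k <- s) wcoef f k <= 1.
Proof.
move=> fB us; apply: le_trans (wiener_ball_sum_powR fB us).
rewrite big_seq [leRHS]big_seq; apply: ler_sum => k ks.
apply: le_powR_le1; first by rewrite p0.
rewrite wcoef_ge0 /=; apply: (powR_le1 p0); first exact: wcoef_ge0.
apply: le_trans (wiener_ball_sum_powR fB us).
by rewrite (bigD1_seq k) //= lerDl; apply: sumr_ge0 => l _; exact: powR_ge0.
Qed.

Lemma wiener_ball_tail f M (s : seq (d.-tuple int)) (P : pred (d.-tuple int)) :
  wiener_ball r p f -> uniq s -> (forall k, P k -> (M < normInf k)%N) ->
  \sum_(k <- s | P k) normc (fourier_coef f k) <= (1 + M%:R) `^ (- r).
Proof.
move=> fB us sM.
have M0 : 0 < 1 + M%:R :> R by apply: ltr_pwDl.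
have a0 : 0 < (1 + M%:R) `^ r by exact: powR_gt0.
rewrite powRN -[leRHS]mul1r ler_pdivlMr //.
apply: le_trans (wiener_ball_sum fB (filter_uniq P us)).
rewrite big_filter mulr_suml; apply: ler_sum => k /sM Mk.
rewrite /wcoef ler_wpM2l ?normc_ge0 //; apply: ge0_ler_powR; rewrite ?nnegrE ?addr_ge0 ?(ltW r0) //.
by rewrite lerD2l ler_nat ltnW.
Qed.

(** This links point values of the continuous representative to its coefficients: partial sums over
    larger boxes differ by a tail, and inversion passes to the limit. *)
Lemma wiener_ball_psum f M : wiener_ball r p f ->
  forall x, normc (f x - psum f M x) <= (1 + M%:R) `^ (- r).
Proof.
move=> fB; have [[pf cf fi _] _] := fB.
apply: fourier_inversion => // M' x MM'.
rewrite /psum (big_box_sub _ MM') addrC addKr.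
apply: le_trans (le_normc_sum _ _ _) _.
under eq_bigr do rewrite normcM normc_expi mulr1.
exact: wiener_ball_tail (box_uniq _ _) _.
Qed.

Lemma wiener_ball_measurable f : wiener_ball r p f -> measurable_torus f.
Proof. by move=> [[_ _ fi _] _]; exact: integrable_torus_measurable. Qed.

Lemma wiener_ball_L2 f : wiener_ball r p f -> L2 f.
Proof.
move=> fB; split.
- by case: fB => -[].
- exact: wiener_ball_measurable.
apply: le_lt_trans (ltry _).
apply: (L2norm_le (wiener_ball_measurable fB) (box_uniq d 0) _
  (wiener_ball_psum 0 fB)); exact: powR_ge0.
Qed.

Lemma L2norm_wiener_ball_sub f g M : wiener_ball r p f -> wiener_ball r p g ->
  (L2norm (fun x => (f x - g x)%R) <= (Num.sqrt (
     2 * \sum_(k <- box d M) normc (fourier_coef f k - fourier_coef g k) ^+ 2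
     + 8 * ((1 + M%:R) `^ (- r)) ^+ 2))%:E)%E.
Proof.
move=> fB gB; set eta := (1 + M%:R) `^ (- r).
have eta0 : 0 <= eta by exact: powR_ge0.
have -> : 8 * eta ^+ 2 = 2 * (2 * eta) ^+ 2 by ring.
apply: (@L2norm_le _ _ _ _ (fun k => fourier_coef f k - fourier_coef g k)).
- have -> : (fun x => f x - g x) = (fun x => f x + (-1) * g x).
    by apply/funext => x; rewrite mulN1r.
  apply: measurable_torusD; first exact: wiener_ball_measurable.
  apply: measurable_torusM; first exact: measurable_torus_cst.
  exact: wiener_ball_measurable.
- exact: box_uniq.
- by rewrite mulr_ge0.
move=> x; under eq_bigr do rewrite mulrBl.
rewrite sumrB -/(psum f M x) -/(psum g M x).
have -> : f x - g x - (psum f M x - psum g M x)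
  = (f x - psum f M x) + - (g x - psum g M x) by ring.
apply: le_trans (le_normcD _ _) _; rewrite normcN.
have := wiener_ball_psum M fB x; have := wiener_ball_psum M gB x; rewrite -/eta; lra.
Qed.

End WienerBall.

(** * Characters on the grid *)

Section Grid.
Context (R : realType) (d M : nat).
Local Notation q := (2 * M).+1.
Local Notation grid := {ffun 'I_d -> 'I_q}.
Local Notation pt := (torus_pt R d).

Definition grid_pt (g : grid) : pt := [tuple (g i)%:R / q%:R | i < d].

Definition unit_exp (x : R) : complex R := (cos (2 * pi * x) +i* sin (2 * pi * x))%C.

Lemma unit_expD x y : unit_exp (x + y) = unit_exp x * unit_exp y.
Proof.
rewrite /unit_exp mulrDr cosD sinD.
by apply: complex_eqP; rewrite ?Re_mulc ?Im_mulc //= addrC.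
Qed.

Lemma unit_exp_int (k : int) : unit_exp k%:~R = 1.
Proof.
by rewrite /unit_exp -[2 * pi * _]add0r cosD2piz sinD2piz cos0 sin0.
Qed.

Lemma unit_expMn x n : unit_exp (x * n%:R) = unit_exp x ^+ n.
Proof.
elim: n => [|n IH]; first by rewrite mulr0 expr0 (unit_exp_int 0).
by rewrite -natr1 mulrDr mulr1 unit_expD IH exprSr.
Qed.

Lemma expi_prod k (x : pt) :
  expi k x = \prod_i unit_exp ((tnth k i)%:~R * tnth x i).
Proof.
rewrite -[LHS]/(unit_exp (pairing k x)) /pairing.
apply: (big_morph unit_exp unit_expD); exact: (unit_exp_int 0).
Qed.

(** A point where the cosine equals 1 is arbitrarily close to an integer. Closeness 1/q suffices: it
    makes [k + n * q] an integer of absolute value below 1. *)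
Lemma unit_exp_eq1 (k : int) : unit_exp (k%:~R / q%:R) = 1 -> (q%:Z %| k)%Z.
Proof.
move=> [hc _]; have q0 : 0 < q%:R :> R by rewrite ltr0n.
have q0' : 0 < q%:R^-1 :> R by rewrite invr_gt0.
have [kap kap0 H] := cos_near_int q0'.
have [n hn] : exists n : int, `|k%:~R / q%:R + n%:~R| < q%:R^-1 :> R.
  by apply: H; rewrite hc subrr.
have h : `|k + n * q%:Z| < 1.
  rewrite -(ltr_int R) intr_norm rmorphD rmorphM /=.
  have -> : k%:~R + n%:~R * q%:R = (k%:~R / q%:R + n%:~R) * q%:R :> R.
    by field; rewrite gt_eqF.
  rewrite normrM (ger0_norm (ltW q0)) -ltr_pdivlMr // mul1r; exact: hn.
have -> : k = - n * q%:Z by lia.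
exact: dvdz_mull.
Qed.

Lemma sum_unit_exp (k : int) :
  \sum_(j < q) unit_exp (k%:~R * (j%:R / q%:R))
    = if (q%:Z %| k)%Z then q%:R else 0.
Proof.
have q0 : q%:R != 0 :> R by rewrite pnatr_eq0.
pose z := unit_exp (k%:~R / q%:R).
have -> : \sum_(j < q) unit_exp (k%:~R * (j%:R / q%:R)) = \sum_(j < q) z ^+ j.
  by apply: eq_bigr => j _; rewrite -unit_expMn mulrA mulrAC.
case: ifPn => [/dvdzP[n kn]|kq].
  have -> : z = 1.
    by rewrite /z kn rmorphM /= mulfK // unit_exp_int.
  by under eq_bigr do rewrite expr1n; rewrite sumr_const card_ord.
have z1 : z - 1 != 0.
  by rewrite subr_eq0; apply: contra kq => /eqP /unit_exp_eq1.
apply: (mulfI z1); rewrite mulr0 -subrX1 -unit_expMn divfK //.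
by rewrite unit_exp_int subrr.
Qed.

Lemma sum_grid_expi k : \sum_(g : grid) expi k (grid_pt g)
  = if [forall i, (q%:Z %| tnth k i)%Z] then #|grid|%:R else 0 :> complex R.
Proof.
under eq_bigr do rewrite expi_prod.
under eq_bigr do under eq_bigr do rewrite tnth_mktuple.
rewrite -(bigA_distr_bigA (fun i (j : 'I_q) =>
   unit_exp ((tnth k i)%:~R * (j%:R / q%:R)))) /=.
under eq_bigr do rewrite sum_unit_exp.
case: ifPn => [/forallP H|/forallPn[i hi]].
  rewrite (eq_bigr (fun=> q%:R)); last by move=> i _; rewrite H.
  by rewrite prodr_const card_ffun !card_ord natrX.
by rewrite (bigD1 i) //= (negbTE hi) mul0r.
Qed.

Definition grid_char (kap g : grid) : complex R := expi (box_freq kap) (grid_pt g).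

Lemma sum_grid_char kap lam :
  \sum_g grid_char kap g * ((grid_char lam g)^*)%C
    = if kap == lam then #|grid|%:R else 0 :> complex R.
Proof.
rewrite (eq_bigr (fun g => expi (addz (box_freq kap) (oppz (box_freq lam))) (grid_pt g)));
  last by move=> g _; rewrite expi_addz expi_oppz.
rewrite sum_grid_expi; congr (if _ then _ else _).
apply/forallP/eqP => [H|-> i]; last by rewrite !tnth_mktuple subrr dvdz0.
apply/ffunP => i; apply: val_inj.
change (nat_of_ord (kap i) = nat_of_ord (lam i)).
have := H i; rewrite !tnth_mktuple.
have := ltn_ord (kap i); have := ltn_ord (lam i).
move: (nat_of_ord (kap i)) (nat_of_ord (lam i)) => a b ha hb.
have -> : a%:Z - M%:Z - (b%:Z - M%:Z) = a%:Z - b%:Z by ring.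
move=> /dvdzP[n hn].
move: q ha hb hn => Q hb ha hn.
have [n0|n0|n0] := ltrgtP n 0.
- have : n * Q%:Z <= - Q%:Z by rewrite -[leRHS]mulN1r ler_wpM2r //; lia.
  lia.
- have : Q%:Z <= n * Q%:Z by rewrite -[leLHS]mul1r ler_wpM2r //; lia.
  lia.
by rewrite n0 mul0r in hn; lia.
Qed.

Lemma parseval_grid (c : grid -> complex R) :
  \sum_g normc (\sum_kap c kap * grid_char kap g) ^+ 2
    = #|grid|%:R * \sum_kap normc (c kap) ^+ 2.
Proof.
have sqE (z : complex R) : normc z ^+ 2 = complex.Re (z * (z^*)%C).
  by rewrite sqr_normcE; case: z => a b /=; ring.
under eq_bigr do rewrite sqE.
rewrite -Re_sum.
have -> : \sum_g (\sum_kap c kap * grid_char kap g)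
     * ((\sum_kap c kap * grid_char kap g)^*)%C
   = \sum_kap (#|grid|%:R : R)%:C%C * (c kap * ((c kap)^*)%C).
  transitivity (\sum_kap \sum_lam (c kap * ((c lam)^*)%C) *
      \sum_g grid_char kap g * ((grid_char lam g)^*)%C).
    under eq_bigr do rewrite rmorph_sum mulr_suml.
    rewrite exchange_big /=; apply: eq_bigr => kap _.
    under eq_bigr do rewrite mulr_sumr.
    rewrite exchange_big /=; apply: eq_bigr => lam _.
    rewrite mulr_sumr; apply: eq_bigr => g _; rewrite rmorphM /=; ring.
  apply: eq_bigr => kap _.
  rewrite (bigD1 kap) //= sum_grid_char eqxx big1 ?addr0; last first.
    by move=> lam; rewrite eq_sym sum_grid_char => /negbTE ->; rewrite mulr0.
  by rewrite rmorph_nat mulrC.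
rewrite Re_sum mulr_sumr; apply: eq_bigr => kap _.
by rewrite Re_realM sqE.
Qed.

Lemma normc_grid_char kap g : normc (grid_char kap g) <= 1.
Proof. by rewrite normc_expi. Qed.

(** The residue is taken after a shift by [M], which [box_freq] undoes: the aliased frequency is the
    representative of [k] modulo q in [-M, M]. *)
Definition alias (k : d.-tuple int) : grid :=
  [ffun i => inord `|((tnth k i + M%:Z) %% q%:Z)%Z|%N].

Lemma expi_grid_pt k g : expi k (grid_pt g) = grid_char (alias k) g.
Proof.
rewrite /grid_char !expi_prod; apply: eq_bigr => i _.
rewrite !tnth_mktuple /alias ffunE.
have h0 : 0 <= ((tnth k i + M%:Z) %% q%:Z)%Z by apply: modz_ge0.
have h1 : ((tnth k i + M%:Z) %% q%:Z)%Z < q%:Z by apply: ltz_pmod.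
rewrite inordK; last by lia.
have kE : tnth k i = `|((tnth k i + M%:Z) %% q%:Z)%Z|%N%:Z - M%:Z
    + ((tnth k i + M%:Z) %/ q%:Z)%Z * q%:Z.
  have := divz_eq (tnth k i + M%:Z) q%:Z; lia.
rewrite {1}kE; set a := (_ - M%:Z); set b := (_ %/ _)%Z.
rewrite rmorphD /= mulrDl unit_expD -[RHS]mulr1; congr (_ * _).
rewrite rmorphM /= -mulrA (_ : q%:~R * _ = (g i)%:~R) -?intrM ?unit_exp_int //.
by rewrite mulrCA mulfV ?mulr1 // pnatr_eq0.
Qed.

End Grid.

(** * Recovery *)

(** With n terms, sum T and sum of squares Q, the sum of the squares [(n * x i - T) ^+ 2] is n(nQ -
    T^2). *)
Lemma sqr_sum_le (R : realFieldType) (I : Type) (s : seq I) (P : pred I) (x : I -> R) :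
  (\sum_(i <- s | P i) x i) ^+ 2 <= (count P s)%:R * \sum_(i <- s | P i) x i ^+ 2.
Proof.
set T := \sum_(i <- s | P i) x i; set Q := \sum_(i <- s | P i) x i ^+ 2.
pose n : R := (count P s)%:R.
have cst (c : R) : \sum_(i <- s | P i) c = n * c.
  by rewrite big_const_seq iter_addr_0 mulr_natl.
have h : 0 <= \sum_(i <- s | P i) (n * x i - T) ^+ 2.
  by apply: sumr_ge0 => i _; exact: sqr_ge0.
have E : \sum_(i <- s | P i) (n * x i - T) ^+ 2 = n * (n * Q - T ^+ 2).
  rewrite (eq_bigr (fun i => n ^+ 2 * x i ^+ 2 + - (2 * n * T) * x i + T ^+ 2));
    last by move=> i _; ring.
  rewrite !big_split /= -!mulr_sumr cst -/T -/Q; ring.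
have [n0|n0] := posnP (count P s).
  have : T = 0.
    by rewrite /T -big_filter (@size0nil _ [seq i <- s | P i]) ?big_nil // size_filter.
  by move=> ->; rewrite expr0n /= n0 mul0r.
have np : 0 < n by rewrite ltr0n.
by move: h; rewrite E pmulr_rge0 // subr_ge0.
Qed.

Section Recovery.
Context (R : realType) (d : nat) (r p : R).
Hypotheses (d0 : (0 < d)%N) (r0 : 0 < r) (p0 : 0 < p) (p1 : p <= 1).
Local Notation pt := (torus_pt R d).
Local Notation B := (@wiener_ball R d r p).
Implicit Types (f g : pt -> complex R).

(* The decoder returns any element of the ball that interpolates the data. *)
Lemma sampling_number_le m (t : 'I_m -> pt) (b : \bar R) :
  (forall f g, B f -> B g -> (forall j, f (t j) = g (t j)) ->
     (L2norm (fun x => f x - g x)%R <= b)%E) ->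
  (sampling_number m B <= b)%E.
Proof.
move=> H.
have /choice[rec hrec] : forall y : 'I_m -> complex R, exists g : pt -> complex R,
    L2 g /\ ((exists f, B f /\ forall j, f (t j) = y j) ->
             B g /\ forall j, g (t j) = y j).
  move=> y; have [[f [Bf fy]]|nf] := pselect (exists f, B f /\ forall j, f (t j) = y j).
    by exists f; split => //; exact: wiener_ball_L2 Bf.
  (* Data produced by no member of the ball still need an image in L2. *)
  exists (fun=> 0); split => //; split.
  - by move=> x k.
  - exact: measurable_torus_cst.
  - apply: le_lt_trans (ltry _).
    apply: (@L2norm_le _ _ _ [::] (fun=> 0) 0) => //.
    by move=> x; rewrite big_nil subrr normc0.
apply: (@le_trans _ _ (ereal_sup
   [set L2norm (fun x => f x - rec (fun j => f (t j)) x)%R | f in B])).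
  apply: le_trans (ereal_inf_lbound _) _; first by exists t.
  by apply: ereal_inf_lbound; exists rec => // y; case: (hrec y).
apply: ge_ereal_sup => _ [f Bf <-].
have [_ /(_ _)[]] := hrec (fun j => f (t j)); first by exists f.
by move=> Bg fg; apply: H.
Qed.

Section OnGrid.
Variables (M m s : nat).
Local Notation q := (2 * M).+1.
Local Notation grid := {ffun 'I_d -> 'I_q}.
Variable t : 'I_m -> grid.
Hypothesis t_discretizes : forall c : grid -> complex R,
  (\sum_k normc (c k)) ^+ 2 <= s%:R * \sum_k normc (c k) ^+ 2 ->
  exists j, \sum_k normc (c k) ^+ 2
    <= 16 * normc (\sum_k c k * grid_char R k (t j)) ^+ 2.

Let eta : R := (1 + M%:R) `^ (- r).
Let eta_gt0 : 0 < eta. Proof. by apply: powR_gt0; rewrite ltr_pwDl. Qed.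

Let coefB f g k := fourier_coef f k - fourier_coef g k.

Let psumB_grid f g (x : grid) :
  psum f M (grid_pt R x) - psum g M (grid_pt R x)
    = \sum_kap coefB f g (box_freq kap) * grid_char R kap x.
Proof.
transitivity (\sum_(k <- box d M) coefB f g k * expi k (grid_pt R x)).
  by rewrite /psum -sumrB; apply: eq_bigr => k _; rewrite -mulrBl.
by rewrite big_box.
Qed.

Let psumB_close f g x : B f -> B g ->
  normc ((f x - g x) - (psum f M x - psum g M x)) <= 2 * eta.
Proof.
move=> Bf Bg.
have -> : (f x - g x) - (psum f M x - psum g M x)
  = (f x - psum f M x) + - (g x - psum g M x) by ring.
apply: le_trans (le_normcD _ _) _; rewrite normcN.
have := wiener_ball_psum d0 r0 p0 p1 M Bf x.
have := wiener_ball_psum d0 r0 p0 p1 M Bg x; rewrite -/eta; lra.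
Qed.

(* The approximants may use frequencies outside the box: on the grid these alias
   to box frequencies, which preserves sparsity. *)
Lemma recovery_of_sparse_approx n (sigma : R) f g :
  (2 * n <= s)%N -> B f -> B g ->
  (forall j, f (grid_pt R (t j)) = g (grid_pt R (t j))) ->
  (exists J c, (#|` J| <= n)%N /\ forall x, normc (f x - trig_poly J c x) <= sigma) ->
  (exists J c, (#|` J| <= n)%N /\ forall x, normc (g x - trig_poly J c x) <= sigma) ->
  (L2norm (fun x => f x - g x)%R <= (20 * (sigma + eta))%:E)%E.
Proof.
move=> ns Bf Bg fg [J [c [Jn fJ]]] [J' [c' [Jn' gJ]]].
have sig0 : 0 <= sigma by apply: le_trans (fJ (@grid_pt R d M [ffun=> ord0])); exact: normc_ge0.
pose D (kap : grid) : complex R :=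
  \sum_(k <- J | alias M k == kap) c k - \sum_(k <- J' | alias M k == kap) c' k.
have aliasE (J0 : {fset d.-tuple int}) c0 (x : grid) :
  trig_poly J0 c0 (grid_pt R x) =
  \sum_kap (\sum_(k <- J0 | alias M k == kap) c0 k) * grid_char R kap x.
  rewrite /trig_poly.
  under eq_bigr do rewrite expi_grid_pt.
  rewrite (partition_big (alias M) xpredT) //=; apply: eq_bigr => kap _.
  by rewrite mulr_suml; apply: eq_bigr => k /eqP ->.
have DE (x : grid) : trig_poly J c (grid_pt R x) - trig_poly J' c' (grid_pt R x)
   = \sum_kap D kap * grid_char R kap x.
  by rewrite !aliasE -sumrB; apply: eq_bigr => kap _; rewrite -mulrBl.
pose supp := [seq alias M k | k <- J] ++ [seq alias M k | k <- J'].
have suppD kap : D kap != 0 -> kap \in supp.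
  apply: contraNT; rewrite mem_cat negb_or => /andP[h1 h2].
  rewrite /D !big1_seq ?subrr // => k /andP[/eqP ak kJ].
    by case/negP: h2; apply/mapP; exists k.
  by case/negP: h1; apply/mapP; exists k.
have Dsparse : (\sum_k normc (D k)) ^+ 2 <= s%:R * \sum_k normc (D k) ^+ 2.
  have restr (F : grid -> R) : (forall k, D k = 0 -> F k = 0) ->
      \sum_k F k = \sum_(k | D k != 0) F k.
    move=> FD; rewrite [LHS](bigID (fun k => D k != 0)) /= [X in _ + X]big1 ?addr0 //.
    by move=> k; rewrite negbK => /eqP /FD.
  rewrite !restr; try by move=> k ->; rewrite normc0 ?expr0n.
  apply: le_trans (sqr_sum_le _ _ _) _; apply: ler_wpM2r.
    by apply: sumr_ge0 => k _; exact: sqr_ge0.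
  rewrite ler_nat; apply: leq_trans ns.
  rewrite -size_filter; apply: leq_trans (_ : size supp <= _)%N.
    apply: uniq_leq_size; first by rewrite filter_uniq // index_enum_uniq.
    by move=> k; rewrite mem_filter => /andP[/suppD].
  by rewrite size_cat !size_map mul2n -addnn leq_add.
have [j hj] := t_discretizes Dsparse.
(* [f] and [g] agree at the sample point, so the approximants differ there by at most [2 * sigma],
   and 64 is 16 times 4. *)
have D2 : \sum_k normc (D k) ^+ 2 <= 64 * sigma ^+ 2.
  apply: le_trans hj _; rewrite -DE.
  set x := grid_pt R (t j).
  have -> : trig_poly J c x - trig_poly J' c' x
     = - (f x - trig_poly J c x) + (g x - trig_poly J' c' x).
    by rewrite /x fg; ring.
  have h : normc (- (f x - trig_poly J c x) + (g x - trig_poly J' c' x)) <= 2 * sigma.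
    apply: le_trans (le_normcD _ _) _; rewrite normcN.
    have := fJ x; have := gJ x; lra.
  have : normc (- (f x - trig_poly J c x) + (g x - trig_poly J' c' x)) ^+ 2
     <= (2 * sigma) ^+ 2.
    by rewrite ler_sqr ?nnegrE ?normc_ge0 // mulr_ge0.
  rewrite exprMn; lra.
have N0 : 0 < #|grid|%:R :> R by rewrite ltr0n; apply/card_gt0P; exists [ffun=> ord0].
pose H (kap : grid) := coefB f g (box_freq kap).
(* Here approximation in the sup norm is essential: the polynomials with coefficients [H] and [D]
   differ by at most [2 * eta + 2 * sigma] at every grid point, also off the sample, and Parseval on
   the grid carries this over to the coefficients. *)
have H2 : \sum_kap normc (H kap) ^+ 2
    <= 2 * (2 * eta + 2 * sigma) ^+ 2 + 2 * \sum_k normc (D k) ^+ 2.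
  rewrite -(ler_pM2l N0) -parseval_grid mulrDr.
  rewrite [X in _ + X]mulrCA -parseval_grid.
  have -> : #|grid|%:R * (2 * (2 * eta + 2 * sigma) ^+ 2)
      = \sum_(x : grid) 2 * (2 * eta + 2 * sigma) ^+ 2.
    by rewrite sumr_const mulr_natl.
  rewrite [X in _ + X]mulr_sumr -big_split /=; apply: ler_sum => x _.
  rewrite -DE -psumB_grid; set y := grid_pt R x.
  set a := psum f M y - psum g M y; set b := trig_poly J c y - trig_poly J' c' y.
  have hab : normc a <= 2 * eta + 2 * sigma + normc b.
    have -> : a = - ((f y - g y) - a) + (f y - trig_poly J c y)
        + - (g y - trig_poly J' c' y) + b by rewrite /b; ring.
    apply: le_trans (le_normcD _ _) _; rewrite lerD2r.
    apply: le_trans (le_normcD _ _) _; rewrite normcN.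
    have h1 := le_normcD (- (f y - g y - a)) (f y - trig_poly J c y).
    rewrite normcN in h1.
    have := psumB_close y Bf Bg; have := fJ y; have := gJ y.
    rewrite -/a; lra.
  apply: (@le_trans _ _ ((2 * eta + 2 * sigma + normc b) ^+ 2)).
    rewrite ler_sqr ?nnegrE ?normc_ge0 //.
    by rewrite !addr_ge0 ?normc_ge0 ?mulr_ge0 // ltW.
  have := sqr_ge0 (2 * eta + 2 * sigma - normc b).
  rewrite sqrrB [in X in _ -> X <= _]sqrrD; lra.
apply: le_trans (L2norm_wiener_ball_sub d0 r0 p0 p1 M Bf Bg) _.
have s20 : 0 <= 20 * (sigma + eta) by rewrite mulr_ge0 // addr_ge0 // ltW.
rewrite lee_fin -[leRHS]ger0_norm // -sqrtr_sqr ler_sqrt ?sqr_ge0 //.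
rewrite big_box -/eta.
have e0 := ltW eta_gt0.
have : 0 <= sigma * eta by rewrite mulr_ge0.
have := sqr_ge0 sigma; have := sqr_ge0 eta.
move: H2 D2; rewrite /H /coefB; rewrite !expr2; nra.
Qed.

Lemma recovery_of_coef_tails f g (j0 : nat) (tau : R) (P : pred (d.-tuple int)) :
  (0 < j0)%N -> s = (4 * j0)%N -> B f -> B g ->
  (forall j, f (grid_pt R (t j)) = g (grid_pt R (t j))) ->
  (count P (box d M) <= j0)%N -> 0 <= tau ->
  \sum_(k <- box d M | ~~ P k) normc (fourier_coef f k) <= tau ->
  \sum_(k <- box d M | ~~ P k) normc (fourier_coef g k) <= tau ->
  (L2norm (fun x => f x - g x)%R <= (12 * (Num.sqrt (tau ^+ 2 / j0%:R) + eta))%:E)%E.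
Proof.
move=> j00 sE Bf Bg fg PJ tau0 ft gt.
have j0R : 0 < j0%:R :> R by rewrite ltr0n.
have e0 := ltW eta_gt0.
pose c (kap : grid) := coefB f g (box_freq kap).
set rho2 := tau ^+ 2 / j0%:R.
have rho0 : 0 <= rho2 by rewrite divr_ge0 ?sqr_ge0 // ltW.
set A := \sum_kap normc (c kap) ^+ 2.
have AE : A = \sum_(k <- box d M) normc (coefB f g k) ^+ 2 by rewrite big_box.
have A0 : 0 <= A by apply: sumr_ge0 => k _; exact: sqr_ge0.
have A2 : A <= 64 * eta ^+ 2 + 4 * rho2.
  (* Either the difference is effectively sparse and the sample controls it, or
     its l1 norm exceeds [2 sqrt j0] times its l2 norm and its tail does. *)
  have [hs|hs] := leP ((\sum_k normc (c k)) ^+ 2) (s%:R * A).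
    have [j hj] := t_discretizes hs.
    rewrite -psumB_grid in hj; set x := grid_pt R (t j) in hj.
    have := psumB_close x Bf Bg; rewrite /x fg subrr sub0r normcN -/x => h.
    have : normc (psum f M x - psum g M x) ^+ 2 <= (2 * eta) ^+ 2.
      by rewrite ler_sqr ?nnegrE ?normc_ge0 // mulr_ge0.
    rewrite exprMn -/A in hj *; lra.
  have T1 : \sum_k normc (c k) <= \sum_(k <- box d M | P k) normc (coefB f g k) + 2 * tau.
    rewrite -(big_box M (fun k => normc (coefB f g k))) (bigID P) /= lerD2l.
    apply: (@le_trans _ _ (\sum_(k <- box d M | ~~ P k)
       (normc (fourier_coef f k) + normc (fourier_coef g k)))).
      apply: ler_sum => k _; rewrite -(normcN (fourier_coef g k)).
      exact: (le_normcD (fourier_coef f k) (- fourier_coef g k)).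
    rewrite big_split /=; lra.
  set X := \sum_(k <- box d M | P k) _ in T1.
  have X0 : 0 <= X by apply: sumr_ge0 => k _; exact: normc_ge0.
  have X2 : X ^+ 2 <= j0%:R * A.
    apply: le_trans (sqr_sum_le _ _ _) _.
    apply: ler_pM; rewrite ?ler_nat //; first by apply: sumr_ge0 => k _; exact: sqr_ge0.
    rewrite AE [leRHS](bigID P) /= lerDl; apply: sumr_ge0 => k _; exact: sqr_ge0.
  pose Y := Num.sqrt (j0%:R * A).
  have Y2 : Y ^+ 2 = j0%:R * A by rewrite sqr_sqrtr // mulr_ge0 // ltW.
  have Y0 : 0 <= Y by exact: sqrtr_ge0.
  have XY : X <= Y by rewrite -ler_sqr ?nnegrE // Y2.
  have T2 : 2 * Y < \sum_k normc (c k).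
    rewrite -ltr_sqr ?nnegrE ?mulr_ge0 //; last first.
      by apply: sumr_ge0 => k _; exact: normc_ge0.
    apply: le_lt_trans hs; rewrite exprMn Y2 sE natrM; lra.
  (* The l1 norm exceeds [2 * Y], by the factor 4 in [s], and the retained frequencies account for
     at most [Y] of it; the two tails must supply the rest. *)
  have Yt : Y <= 2 * tau by lra.
  have : Y ^+ 2 <= (2 * tau) ^+ 2 by rewrite ler_sqr ?nnegrE // mulr_ge0.
  rewrite Y2 exprMn => h.
  have : A <= 4 * rho2.
    by rewrite /rho2 mulrA ler_pdivlMr // mulrC; lra.
  have := sqr_ge0 eta; lra.
apply: le_trans (L2norm_wiener_ball_sub d0 r0 p0 p1 M Bf Bg) _.
rewrite -/eta; set rho := Num.sqrt rho2.
have r2 : rho ^+ 2 = rho2 by rewrite sqr_sqrtr.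
have rh0 : 0 <= rho by exact: sqrtr_ge0.
have s20 : 0 <= 12 * (rho + eta) by rewrite mulr_ge0 // addr_ge0.
rewrite lee_fin -[leRHS]ger0_norm // -sqrtr_sqr ler_sqrt ?sqr_ge0 //.
have : 0 <= rho * eta by rewrite mulr_ge0.
have := sqr_ge0 eta; move: A2; rewrite AE -r2 /coefB !expr2; lra.
Qed.

End OnGrid.

End Recovery.

Lemma natceil_ge (R : realType) (x : R) : x <= (natceil x)%:R.
Proof.
apply: (@le_trans _ _ (Num.ceil x)%:~R); first exact: ceil_ge.
rewrite /natceil [leRHS]pmulrn ler_int; lia.
Qed.

Lemma ln_exp_le (R : realType) (a b e : nat) : (0 < a)%N -> (a <= b ^ e)%N ->
  ln a%:R <= e%:R * ln b%:R :> R.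
Proof.
move=> a0 ab; have b0 : (0 < b ^ e)%N by apply: leq_trans ab.
apply: (@le_trans _ _ (ln (b ^ e)%:R)).
  by rewrite ler_ln ?posrE ?ltr0n // ler_nat.
case: e ab b0 => [|e] ab b0; first by rewrite expn0 ln1 mul0r.
by rewrite natrX lnXn ?mulr_natl // ltr0n; move: b0; rewrite expn_gt0 orbF.
Qed.

(** The integer part of n^(1/d): a box of this radius has of order n frequencies, and outside it the
    Wiener weight is at least n^(r/d). *)
Lemma floor_root (d n : nat) : (0 < d)%N -> (0 < n)%N ->
  exists l, [/\ (0 < l)%N, (l ^ d <= n)%N & (n < l.+1 ^ d)%N].
Proof.
move=> d0 n0.
have ex : exists l, (l ^ d <= n)%N by exists 1%N; rewrite exp1n.
have bd l : (l ^ d <= n)%N -> (l <= n)%N.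
  by apply: leq_trans; case: l => // l; rewrite -[X in (X <= _)%N]expn1 leq_pexp2l.
case: (ex_maxnP ex bd) => l ln lmax; exists l; split => //.
  by apply: lmax; rewrite exp1n.
by rewrite ltnNge; apply/negP => /lmax; rewrite ltnn.
Qed.

Lemma count_predU_le (T : Type) (P Q : pred T) (s : seq T) :
  (count (predU P Q) s <= count P s + count Q s)%N.
Proof. by rewrite -count_predUI leq_addr. Qed.

(** * The two bounds for the Wiener ball *)

Section WienerSampling.
Context (R : realType) (d : nat) (r p : R).
Hypotheses (d0 : (0 < d)%N) (r0 : 0 < r) (p0 : 0 < p) (p1 : p <= 1).
Local Notation pt := (torus_pt R d).
Local Notation B := (@wiener_ball R d r p).
Local Notation dc := (discretization_constant R).

Lemma card_grid M : #|{ffun 'I_d -> 'I_(2 * M).+1}| = ((2 * M).+1 ^ d)%N.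
Proof. by rewrite card_ffun !card_ord. Qed.

Lemma exists_grid_sample (M s m : nat) : (0 < s)%N ->
  dc * s%:R * ln s.+1%:R ^+ 2 * ln (4 * (2 * M).+1 ^ d + 1)%:R <= m%:R ->
  exists t : 'I_m -> {ffun 'I_d -> 'I_(2 * M).+1},
  forall c : {ffun 'I_d -> 'I_(2 * M).+1} -> complex R,
    (\sum_k normc (c k)) ^+ 2 <= s%:R * \sum_k normc (c k) ^+ 2 ->
    exists j, \sum_k normc (c k) ^+ 2
      <= 16 * normc (\sum_k c k * grid_char R k (t j)) ^+ 2.
Proof.
move=> s0 hm.
have N0 : (0 < #|{ffun 'I_d -> 'I_(2 * M).+1}|)%N by rewrite card_grid expn_gt0.
apply: exists_discretizing_sample => //.
- by move=> k g; exact: normc_grid_char.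
- exact: parseval_grid.
- by rewrite card_grid.
Qed.

Lemma sampling_le_best_nterm (n M m : nat) : (0 < n)%N ->
  dc * (2 * n)%:R * ln (2 * n).+1%:R ^+ 2 * ln (4 * (2 * M).+1 ^ d + 1)%:R <= m%:R ->
  (sampling_number m B
    <= 40%:E * (best_nterm_width n B + ((1 + M%:R) `^ (- r))%:E))%E.
Proof.
move=> n0 hm; set eta := (1 + M%:R) `^ (- r).
have eta0 : 0 < eta by apply: powR_gt0; rewrite ltr_pwDl.
have n20 : (0 < 2 * n)%N by rewrite muln_gt0.
have [t ht] := exists_grid_sample n20 hm.
apply: (@sampling_number_le _ _ _ _ d0 r0 p0 p1 _ (fun j => grid_pt R (t j))) => f g Bf Bg fg.
have errle h : B h -> (best_nterm_err n h <= best_nterm_width n B)%E.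
  by move=> Bh; apply: ereal_sup_ubound; exists h.
have err0 (h : pt -> complex R) : (0 <= best_nterm_err n h)%E.
  apply: le_ereal_inf_tmp => _ [J [c [_ ->]]].
  pose z : pt := [tuple 0 | _ < d].
  apply: (@le_trans _ _ (normc (h z - trig_poly J c z))%:E).
    by rewrite lee_fin normc_ge0.
  by apply: ereal_sup_ubound; exists z.
move: errle; case: (best_nterm_width n B) => [w| |] errle.
(* The infimum defining the best error need not be attained; a slack of [eta] is affordable and
   accounts for passing from 20 to 40. *)
- have approx h : B h -> exists J c, (#|` J| <= n)%N /\
      forall x, normc (h x - trig_poly J c x) <= w + eta.
    move=> /errle hw.
    have : (best_nterm_err n h < (w + eta)%:E)%E.
      by apply: le_lt_trans hw _; rewrite lte_fin ltrDl.
    move=> /ereal_inf_lt[_ [J [c [Jn ->]]] lt]; exists J, c; split => // x.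
    rewrite -lee_fin; apply: le_trans (ltW lt).
    by apply: ereal_sup_ubound; exists x.
  have w0 : 0 <= w by rewrite -lee_fin; exact: le_trans (err0 f) (errle f Bf).
  apply: le_trans (recovery_of_sparse_approx d0 r0 p0 p1 ht (leqnn _) Bf Bg fg
    (approx f Bf) (approx g Bg)) _.
  rewrite -EFinD -EFinM lee_fin -/eta; lra.
- by rewrite addye // gt0_muley ?leey // lte_fin.
- by have := le_trans (err0 f) (errle f Bf); rewrite leeNy_eq.
Qed.

Section Tails.
Variables (n l : nat).
Hypotheses (n0 : (0 < n)%N) (nl : (n < l.+1 ^ d)%N).
Let x : R := n%:R.
Let x1 : 1 <= x. Proof. by rewrite ler1n. Qed.
Let x0 : 0 < x. Proof. by rewrite ltr0n. Qed.

Let big_coef (f : pt -> complex R) k := x `^ (- p^-1) < wcoef r f k.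

(** Each coefficient above the threshold contributes at least 1/n to a sum of p-th powers that is at
    most 1. *)
Lemma count_big_coef f M : B f -> (count (big_coef f) (box d M) <= n)%N.
Proof.
move=> Bf.
have := wiener_ball_sum_powR p0 Bf (filter_uniq (big_coef f) (box_uniq d M)).
rewrite -size_filter; set s := [seq _ <- _ | _] => h.
have : \sum_(k <- s) x^-1 <= \sum_(k <- s) wcoef r f k `^ p.
  rewrite big_seq [leRHS]big_seq; apply: ler_sum => k; rewrite mem_filter => /andP[hk _].
  have -> : x^-1 = (x `^ (- p^-1)) `^ p.
    by rewrite -powRrM mulNr mulVf ?gt_eqF // powR_inv1 // ltW.
  apply: ge0_ler_powR; rewrite ?nnegrE ?powR_ge0 ?(ltW p0) ?wcoef_ge0 //.
  exact: ltW.
rewrite big_const_seq count_predT iter_addr_0 -mulr_natl => h2.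
have := le_trans h2 h; rewrite ler_pdivrMr // mul1r.
by rewrite /x ler_nat.
Qed.

(** Stechkin's estimate: a weighted coefficient w below n^(-1/p) satisfies w = w^(1-p) w^p, at most
    n^(1-1/p) w^p, and the p-th powers sum to at most 1. Removing the weight, which is at least
    n^(r/d) outside the box of radius [l], gains the other factor. *)
Lemma tail_le (f : pt -> complex R) M (P : pred (d.-tuple int)) : B f ->
  (forall k, (normInf k <= l)%N -> P k) -> (forall k, big_coef f k -> P k) ->
  \sum_(k <- box d M | ~~ P k) normc (fourier_coef f k)
    <= x `^ (- (r / d%:R)) * x `^ (1 - p^-1).
Proof.
move=> Bf Pl Pf.
apply: (@le_trans _ _ (\sum_(k <- box d M | ~~ P k)
   x `^ (- (r / d%:R)) * x `^ (1 - p^-1) * wcoef r f k `^ p)).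
  apply: ler_sum => k Pk.
  have kl : (l < normInf k)%N by rewrite ltnNge; apply: contra Pk; exact: Pl.
  have kf : wcoef r f k <= x `^ (- p^-1) by rewrite leNgt; apply: contra Pk; exact: Pf.
  have dR : d%:R != 0 :> R by rewrite pnatr_eq0 -lt0n.
  have wge : x `^ (r / d%:R) <= (1 + (normInf k)%:R) `^ r.
    have k1 : 0 <= 1 + (normInf k)%:R :> R by rewrite addr_ge0.
    have -> : r = d%:R * (r / d%:R) by rewrite mulrCA mulfV ?mulr1.
    rewrite mulrAC mulfV // mul1r [leRHS]powRrM powR_mulrn //.
    apply: ge0_ler_powR; rewrite ?nnegrE ?exprn_ge0 ?(ltW x0) ?divr_ge0 ?(ltW r0) //.
    rewrite addrC natr1.
    rewrite -natrX ler_nat; apply: leq_trans (ltnW nl) _.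
    by rewrite leq_exp2r // ltnS ltnW.
  have w0 := wcoef_ge0 r f k.
  have c1 : normc (fourier_coef f k) <= x `^ (- (r / d%:R)) * wcoef r f k.
    rewrite powRN mulrC ler_pdivlMr ?powR_gt0 //.
    by rewrite /wcoef ler_wpM2l ?normc_ge0.
  apply: le_trans c1 _; rewrite -mulrA ler_wpM2l ?powR_ge0 //.
  move: w0; rewrite le_eqVlt => /orP[/eqP <-|w0].
    by rewrite mulr_ge0 ?powR_ge0.
  rewrite [leLHS](_ : _ = wcoef r f k `^ (1 - p) * wcoef r f k `^ p); last first.
    by rewrite -powRD ?subrK ?powRr1 ?ltW // gt_eqF ?implybT.
  rewrite ler_wpM2r ?powR_ge0 //.
  have -> : x `^ (1 - p^-1) = (x `^ (- p^-1)) `^ (1 - p).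
    rewrite -powRrM; congr (_ `^ _); field; by rewrite gt_eqF.
  by apply: ge0_ler_powR; rewrite ?nnegrE ?powR_ge0 ?(ltW w0) // subr_ge0.
rewrite -mulr_sumr -[leRHS]mulr1 ler_wpM2l ?mulr_ge0 ?powR_ge0 //.
rewrite -big_filter; apply: (wiener_ball_sum_powR p0 Bf).
by rewrite filter_uniq // box_uniq.
Qed.

End Tails.

Lemma count_box l M : (count (fun k => normInf k <= l)%N (box d M) <= (2 * l).+1 ^ d)%N.
Proof.
rewrite -card_grid -size_filter.
apply: (@leq_trans (size (box d l))).
  apply: uniq_leq_size; first by rewrite filter_uniq // box_uniq.
  by move=> k; rewrite mem_filter !mem_box => /andP[].
by rewrite size_codom.
Qed.

Lemma sampling_le_rate (n M m : nat) : (0 < n)%N ->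
  (1 + M%:R) `^ (- r) <= n%:R `^ (- (r / d%:R) - p^-1 + 2^-1) ->
  let s := (4 * ((3 ^ d + 2) * n))%N in
  dc * s%:R * ln s.+1%:R ^+ 2 * ln (4 * (2 * M).+1 ^ d + 1)%:R <= m%:R ->
  (sampling_number m B <= (24 * n%:R `^ (- (r / d%:R) - p^-1 + 2^-1))%:E)%E.
Proof.
move=> n0 Mn s hm.
set rho := n%:R `^ _ in Mn *.
have x0 : 0 < n%:R :> R by rewrite ltr0n.
(* At most 3^d n frequencies from the box of radius [l], as 2l+1 is at most 3l, and n large
   coefficients for each of [f] and [g]. *)
pose j0 := ((3 ^ d + 2) * n)%N.
have j00 : (0 < j0)%N by rewrite muln_gt0 n0 addn2.
have s0 : (0 < s)%N by rewrite muln_gt0.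
have [t ht] := exists_grid_sample s0 hm.
have [l [l0 ln nl]] := floor_root d0 n0.
apply: (@sampling_number_le _ _ _ _ d0 r0 p0 p1 _ (fun j => grid_pt R (t j))) => f g Bf Bg fg.
pose P k := [|| (normInf k <= l)%N, n%:R `^ (- p^-1) < wcoef r f k
  | n%:R `^ (- p^-1) < wcoef r g k].
pose tau : R := n%:R `^ (- (r / d%:R)) * n%:R `^ (1 - p^-1).
have tau0 : 0 <= tau by rewrite mulr_ge0 ?powR_ge0.
have countP : (count P (box d M) <= j0)%N.
  apply: (@leq_trans (count (fun k => normInf k <= l)%N (box d M)
     + (count (fun k => (n%:R `^ (- p^-1) < wcoef r f k)%R) (box d M)
     + count (fun k => (n%:R `^ (- p^-1) < wcoef r g k)%R) (box d M)))%N).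
    apply: leq_trans (count_predU_le _ _ _) _; rewrite leq_add2l.
    exact: count_predU_le.
  rewrite /j0 mulnDl mul2n -addnn; apply: leq_add; last first.
    by apply: leq_add; exact: count_big_coef.
  apply: leq_trans (count_box l M) _.
  apply: (@leq_trans ((3 * l) ^ d)%N); first by rewrite leq_exp2r //; lia.
  by rewrite expnMn leq_mul2l ln orbT.
have tf : \sum_(k <- box d M | ~~ P k) normc (fourier_coef f k) <= tau.
  by apply: (tail_le n0 nl) => // k hk; rewrite /P hk ?orbT.
have tg : \sum_(k <- box d M | ~~ P k) normc (fourier_coef g k) <= tau.
  by apply: (tail_le n0 nl) => // k hk; rewrite /P hk ?orbT.
apply: le_trans (recovery_of_coef_tails d0 r0 p0 p1 ht j00 erefl Bf Bg fg countP
  tau0 tf tg) _.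
rewrite lee_fin.
have rho0 : 0 <= rho by exact: powR_ge0.
have rhoE : rho = tau * n%:R `^ (- 2^-1).
  rewrite /tau -!powRD ?(gt_eqF x0) ?implybT //; congr (_ `^ _).
  by field; rewrite pnatr_eq0 -lt0n d0 gt_eqF.
(* [j0] is at least [n], so the division gains the factor n^(-1/2). *)
have : Num.sqrt (tau ^+ 2 / j0%:R) <= rho.
  rewrite -[leRHS]ger0_norm // -sqrtr_sqr ler_sqrt ?sqr_ge0 //.
  rewrite rhoE [leRHS]exprMn ler_wpM2l ?sqr_ge0 //.
  have -> : (n%:R `^ (- 2^-1)) ^+ 2 = n%:R^-1 :> R.
    rewrite -powR_mulrn ?powR_ge0 // -powRrM mulNr mulVf // powR_inv1 //.
  rewrite lef_pV2 ?posrE ?ltr0n // ler_nat /j0.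
  by rewrite leq_pmull // addn2.
by move: Mn; lra.
Qed.

End WienerSampling.

Theorem corollary4p7 (R : realType) :
  exists C Ct : R, [/\ 0 < C, 0 < Ct &
    forall (r p : R) (d : nat), 0 < r -> 0 < p -> p <= 1 -> (0 < d)%N ->
      (forall n M : nat, (0 < n)%N -> (3 <= M)%N ->
        (sampling_number
           (natceil (C * d%:R * ln (d.+1)%:R * n%:R * ln (n.+1)%:R ^+ 2
                     * ln M%:R))
           (@wiener_ball R d r p)
         <= Ct%:E * (best_nterm_width n (@wiener_ball R d r p)
                     + ((1 + M%:R) `^ (- r))%:E))%E) /\
      (exists Crpd : R, 0 < Crpd /\
       exists c : R, 0 < c /\
       forall n : nat, (0 < n)%N ->
        (sampling_number (natceil (Crpd * n%:R * ln (n.+1)%:R ^+ 3))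
           (@wiener_ball R d r p)
         <= (c * n%:R `^ (- (r / d%:R) - p^-1 + 2^-1))%:E)%E)].
Proof.
have [dc [dcE dc0]] : exists dc : R, dc = discretization_constant R /\ 0 < dc.
  by exists (discretization_constant R); split=> //; rewrite /discretization_constant; lra.
(* For [M] at least 3 both 2M+1 and 5 are at most M^2, so the argument is at most M^(2d+2), hence at
   most M^(4d). *)
have lnN d M : (0 < d)%N -> (3 <= M)%N ->
    ln (4 * (2 * M).+1 ^ d + 1)%:R <= 4 * d%:R * ln M%:R :> R.
  move=> d0 M3; rewrite -natrM; apply: ln_exp_le; first by rewrite addn1.
  have M1 : (0 < M)%N by apply: leq_trans M3.
  have h1 : ((2 * M).+1 ^ d <= M ^ (2 * d))%N.
    by rewrite expnM leq_exp2r //; nia.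
  have h2 : (0 < (2 * M).+1 ^ d)%N by rewrite expn_gt0.
  apply: (@leq_trans (5 * M ^ (2 * d))%N); first by lia.
  apply: (@leq_trans (M ^ 2 * M ^ (2 * d))%N).
    by rewrite leq_mul2r; apply/orP; right; nia.
  by rewrite -expnD leq_pexp2l //; lia.
(* 64 collects 2 from the sparsity [2 * n], 4 from the squared bound of ln(2n+1) by 2 ln(n+1), 4
   from [lnN], and 2 from inserting ln(d+1), which is at least 1/2. *)
exists (64 * dc), 40; split => //; first by rewrite mulr_gt0.
move=> r p d r0 p0 p1 d0; split.
  move=> n M n0 M3; apply: sampling_le_best_nterm => //; rewrite -dcE.
  apply: le_trans (natceil_ge _).
  have ln1 : ln (2 * n).+1%:R <= 2 * ln n.+1%:R :> R.
    by apply: ln_exp_le => //; nia.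
  have ln10 : 0 <= ln (2 * n).+1%:R :> R by rewrite ln_ge0 // ler1n.
  have ln2 : 2^-1 <= ln d.+1%:R :> R by apply: half_le_ln; rewrite ltnS.
  have lnM0 : 0 <= ln M%:R :> R by rewrite ln_ge0 // ler1n (leq_trans _ M3).
  set a := ln (2 * n).+1%:R in ln1 ln10 *; set b := ln n.+1%:R in ln1 *.
  set L := ln M%:R in lnM0 *; set D := ln d.+1%:R in ln2 *.
  have ab : a ^+ 2 <= (2 * b) ^+ 2 by rewrite lerXn2r ?nnegrE //; lra.
  apply: (@le_trans _ _ (dc * (2 * n)%:R * (2 * b) ^+ 2 * (4 * d%:R * L))).
    have h1 : 0 <= dc * (2 * n)%:R by rewrite mulr_ge0 // ltW.
    apply: ler_pM; first by rewrite mulr_ge0 ?sqr_ge0.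
    - by rewrite ln_ge0 // ler1n addn1.
    - by rewrite ler_wpM2l.
    - exact: lnN.
  rewrite natrM.
  have -> : dc * (2 * n%:R) * (2 * b) ^+ 2 * (4 * d%:R * L)
    = 32 * (dc * n%:R * d%:R * b ^+ 2 * L) * 1 by ring.
  have -> : 64 * dc * d%:R * D * n%:R * b ^+ 2 * L
    = 32 * (dc * n%:R * d%:R * b ^+ 2 * L) * (2 * D) by ring.
  rewrite ler_wpM2l //; last by lra.
  have b0 : 0 <= b by lra.
  by rewrite !mulr_ge0 // ltW.
(* The exponent makes [kap * r] at least r/d + 1/p, so that a box of radius at least n^kap has
   truncation error within the rate. *)
pose kap := (Num.truncn ((r / d%:R + p^-1) / r)).+1.
have kapE : (r / d%:R + p^-1) / r <= kap%:R by exact: ltW (truncnS_gt _).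
pose a := (4 * (3 ^ d + 2))%N.
have a0 : (0 < a)%N by rewrite /a muln_gt0 addn2.
pose A1 : R := 1 + 2 * ln a.+1%:R.
have lna0 : 0 <= ln a.+1%:R :> R by rewrite ln_ge0 // ler1n.
have A10 : 0 < A1 by rewrite /A1; lra.
exists (dc * a%:R * A1 ^+ 2 * (8 * d%:R * kap%:R)); split.
  by rewrite !mulr_gt0 ?exprn_gt0 ?ltr0n.
exists 24; split => // n n0.
(* A polynomial size of the box makes ln M of order ln(n+1), which supplies the third logarithm. The
   shift by 2 ensures that [M] is at least 3 already for n = 1. *)
pose M := ((n + 2) ^ kap)%N.
have M3 : (3 <= M)%N.
  apply: (@leq_trans (n + 2)%N); first by rewrite addn2.
  by rewrite -[X in (X <= _)%N]expn1 leq_pexp2l ?addn2.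
apply: (sampling_le_rate d0 r0 p0 p1 (M := M)) => //.
  have x1 : 1 <= n%:R :> R by rewrite ler1n.
  have x0 : 0 < n%:R :> R by rewrite ltr0n.
  apply: (@le_trans _ _ (n%:R `^ (- (r / d%:R + p^-1)))); last first.
    by apply: ler_powR => //; lra.
  have M0 : 0 < 1 + M%:R :> R by rewrite ltr_pwDl.
  rewrite !powRN lef_pV2 ?posrE ?powR_gt0 //.
  apply: (@le_trans _ _ (n%:R `^ (kap%:R * r))).
    by apply: ler_powR => //; rewrite -ler_pdivrMr.
  rewrite powRrM powR_mulrn ?(ltW x0) //.
  apply: ge0_ler_powR; rewrite ?nnegrE ?(ltW r0) ?exprn_ge0 ?addr_ge0 //.
  apply: (@le_trans _ _ M%:R); last by rewrite lerDr.
  by rewrite -natrX ler_nat leq_exp2r // leq_addr.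
rewrite -dcE; apply: le_trans (natceil_ge _).
rewrite mulnA -/a.
set b := ln n.+1%:R.
have b2 : 2^-1 <= b by apply: half_le_ln; rewrite ltnS.
have lns : ln (a * n).+1%:R <= A1 * b.
  apply: (@le_trans _ _ (ln a.+1%:R + b)).
    rewrite -lnM ?posrE ?ltr0n // -natrM ler_ln ?posrE ?ltr0n // ler_nat; nia.
  rewrite /A1 mulrDl mul1r addrC lerD2l mulrAC -[leLHS]mul1r ler_wpM2r //; lra.
have lnMb : ln M%:R <= 2 * kap%:R * b.
  rewrite -natrM; apply: ln_exp_le; first by rewrite expn_gt0 addn2.
  by rewrite /M expnM leq_exp2r //; nia.
have lnNb : ln (4 * (2 * M).+1 ^ d + 1)%:R <= 8 * d%:R * kap%:R * b :> R.
  apply: le_trans (lnN _ _ d0 M3) _.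
  have := ler_wpM2l (_ : 0 <= 4 * d%:R) lnMb; rewrite mulr_ge0 // => /(_ isT); lra.
have -> : dc * a%:R * A1 ^+ 2 * (8 * d%:R * kap%:R) * n%:R * b ^+ 3
  = dc * (a * n)%:R * (A1 * b) ^+ 2 * (8 * d%:R * kap%:R * b) by rewrite natrM; ring.
have h1 : 0 <= dc * (a * n)%:R by rewrite mulr_ge0 // ltW.
apply: ler_pM => //.
- by rewrite mulr_ge0 ?sqr_ge0.
- by rewrite ln_ge0 // ler1n addn1.
- rewrite ler_wpM2l // lerXn2r ?nnegrE //; first by rewrite ln_ge0 // ler1n.
  by apply: mulr_ge0; [exact: ltW|lra].
Qed.
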